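(* Let $k\in\mathbb Z$, $k\ge 0$, and $\theta\in[0,1]$. For any $u_0\in C^{k,\theta}(\mathbb R)$ there exist $T=T(\|u_0\|_{C^{k,\theta}})>0$ and a unique solution $u=u(x,t)$ of the initial value problem $$\partial_t u+(1-\partial_x^2)^{-1}(\partial_x u+u\,\partial_x u)=0,\qquad u(x,0)=u_0(x),$$ such that $$u\in C^\infty\big((-T,T):C^{k,\theta}(\mathbb R)\big)\equiv X_T^{k,\theta}(\mathbb R).$$ Moreover, the data-to-solution map $u_0\mapsto u$ is locally analytic from $C^{k,\theta}(\mathbb R)$ to $X_T^{k,\theta}(\mathbb R)$.
   Context: For $k\in\mathbb Z$, $k\ge0$, and $\theta\in[0,1]$, $C^{k,\theta}(\mathbb R)$ is the space of $f:\mathbb R\to\mathbb R$ of class $C^k$ with $f,f',\dots,f^{(k)}$ bounded and with finite norm $$\|f\|_{C^{k,\theta}}=\sum_{j=0}^k\|f^{(j)}\|_\infty+\sup_{h\ne0}\Big\|\frac{f^{(k)}(\cdot+h)-f^{(k)}(\cdot)}{|h|^\theta}\Big\|_\infty .$$ The nonlocal term is understood as $(1-\partial_x^2)^{-1}(\partial_xu+u\partial_xu)=\partial_x(1-\partial_x^2)^{-1}\big(u+\tfrac{u^2}{2}\big)$, where $\partial_x(1-\partial_x^2)^{-1}g=K*g$ with $K(x)=-\tfrac12\,\mathrm{sgn}(x)e^{-|x|}$. Equivalently, $u(t)=u_0-\int_0^t\partial_x(1-\partial_x^2)^{-1}\big(u+\tfrac{u^2}{2}\big)(t')\,dt'$.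 *)

(* Defs.v *)
From HB Require Import structures.
From mathcomp Require Import all_boot all_order all_algebra.
From mathcomp Require Import all_classical all_reals all_analysis.
Import Order.TTheory GRing.Theory Num.Theory.
Import numFieldNormedType.Exports.

Set Implicit Arguments.
Unset Strict Implicit.
Unset Printing Implicit Defensive.

Local Open Scope ring_scope.
Local Open Scope classical_set_scope.

Section SupNorm.
Context {R : realType}.
Implicit Types f g : R -> R.

Definition supnorm f : \bar R := ereal_sup (range (fun x => `|f x|%:E)).

Lemma supnorm_ub f x : (`|f x|%:E <= supnorm f)%E.
Proof. by apply: ereal_sup_ubound; exists x. Qed.

Lemma supnorm_ge0 f : (0 <= supnorm f)%E.
Proof. by apply: le_trans (supnorm_ub f 0); rewrite lee_fin. Qed.

Lemma supnorm_le f (M : \bar R) :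
  (forall x, (`|f x|%:E <= M)%E) -> (supnorm f <= M)%E.
Proof. by move=> fM; apply: ge_ereal_sup => _ [x _ <-]. Qed.

Lemma supnormD f g :
  (supnorm (fun x => (f x + g x)%R) <= supnorm f + supnorm g)%E.
Proof.
apply: supnorm_le => x.
apply: le_trans (leeD (supnorm_ub f x) (supnorm_ub g x)).
by rewrite -EFinD lee_fin ler_normD.
Qed.

Lemma supnormZ_le (c : R) f :
  (supnorm (fun x => (c * f x)%R) <= `|c|%:E * supnorm f)%E.
Proof.
apply: supnorm_le => x; rewrite normrM EFinM.
by apply: lee_pmul => //; rewrite ?lee_fin // supnorm_ub.
Qed.

End SupNorm.

Section HolderNorm.
Context {R : realType}.
Variables (k : nat) (theta : R).
Implicit Types f g : R -> R.

Definition holder_seminorm f : \bar R :=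
  ereal_sup [set supnorm (fun x => (f (x + h) - f x) / `|h| `^ theta)
            | h in [set h : R | h != 0]].

Definition holder_norm f : \bar R :=
  (\sum_(j < k.+1) supnorm f^`(j) + holder_seminorm f^`(k))%E.

(* All the terms of the norm are nonnegative, so that finiteness of the norm
   includes the boundedness of f, f', ..., f^(k). *)
Definition holder_pred : {pred R -> R} := mem [set f : R -> R |
  [/\ forall j x, (j < k)%N -> derivable (f^`(j)) x 1,
      continuous f^`(k) &
      (holder_norm f < +oo)%E]].

Lemma holderP f : reflect
  [/\ forall j x, (j < k)%N -> derivable (f^`(j)) x 1,
      continuous f^`(k) & (holder_norm f < +oo)%E] (f \in holder_pred).
Proof. by apply: (iffP idP); rewrite !inE. Qed.

Lemma holder_seminorm_ge0 f : (0 <= holder_seminorm f)%E.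
Proof.
apply: le_trans (supnorm_ge0 (fun x => (f (x + 1) - f x) / `|1| `^ theta)) _.
by apply: ereal_sup_ubound; exists 1 => //=; rewrite oner_neq0.
Qed.

Lemma holder_seminormD f g :
  (holder_seminorm (f + g)%R <= holder_seminorm f + holder_seminorm g)%E.
Proof.
apply: ge_ereal_sup => _ [h /= h0 <-].
pose q (u : R -> R) x := (u (x + h) - u x) / `|h| `^ theta.
apply: (@le_trans _ _ (supnorm (q f) + supnorm (q g))%E).
  apply: le_trans (supnormD _ _); apply: supnorm_le => x.
  apply: le_trans (supnorm_ub _ x).
  by rewrite lee_fin /q -mulrDl -[(f + g) _]/(f _ + g _) -[(f + g) x]/(f x + g x)
     opprD addrACA.
by apply: leeD; apply: ereal_sup_ubound; exists h.
Qed.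

Lemma holder_seminormZ_le (c : R) f :
  (holder_seminorm (c *: f)%R <= `|c|%:E * holder_seminorm f)%E.
Proof.
apply: ge_ereal_sup => _ [h /= h0 <-].
pose q x := (f (x + h) - f x) / `|h| `^ theta.
apply: (@le_trans _ _ (`|c|%:E * supnorm q)%E).
  apply: le_trans (supnormZ_le _ _); apply: supnorm_le => x.
  apply: le_trans (supnorm_ub _ x).
  by rewrite lee_fin /q -[(c *: f) _]/(c * f _) -[(c *: f) x]/(c * f x)
     -mulrBr mulrA.
apply: lee_pmul => //; first exact: supnorm_ge0.
by apply: ereal_sup_ubound; exists h.
Qed.

Lemma derive1nD_holder f g j : (j <= k)%N ->
  (forall i x, (i < k)%N -> derivable (f^`(i)) x 1) ->
  (forall i x, (i < k)%N -> derivable (g^`(i)) x 1) ->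
  ((f + g)^`(j) = f^`(j)%classic + g^`(j)%classic)%classic.
Proof.
elim: j => [//|j IH] jk df dg; rewrite !derive1nS (IH (ltnW jk) df dg).
apply/funext => x; rewrite -[RHS]/(_ x + _ x) !derive1E.
by rewrite deriveD//; [exact: df|exact: dg].
Qed.

Lemma derive1nZ_holder (c : R) f j : (j <= k)%N ->
  (forall i x, (i < k)%N -> derivable (f^`(i)) x 1) ->
  ((c *: f)^`(j) = c *: f^`(j)%classic)%classic.
Proof.
elim: j => [//|j IH] jk df; rewrite !derive1nS (IH (ltnW jk) df).
apply/funext => x; rewrite -[RHS]/(c *: (_ x)) !derive1E.
by rewrite deriveZ//; exact: df.
Qed.

Lemma holder_normD f g : f \in holder_pred -> g \in holder_pred ->
  (holder_norm (f + g)%R <= holder_norm f + holder_norm g)%E.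
Proof.
move=> /holderP[df _ _] /holderP[dg _ _].
rewrite /holder_norm addeACA leeD//.
  rewrite -big_split/=; apply: lee_sum => j _.
  by rewrite derive1nD_holder ?leq_ord//; exact: supnormD.
by rewrite derive1nD_holder//; exact: holder_seminormD.
Qed.

Lemma holder_normZ_le (c : R) f : f \in holder_pred ->
  (holder_norm (c *: f)%R <= `|c|%:E * holder_norm f)%E.
Proof.
move=> /holderP[df _ _]; rewrite /holder_norm.
rewrite ge0_muleDr; last 2 first.
- by apply: sume_ge0 => j _; exact: supnorm_ge0.
- exact: holder_seminorm_ge0.
apply: leeD; last by rewrite derive1nZ_holder//; exact: holder_seminormZ_le.
rewrite ge0_sume_distrr; last by move=> j _; exact: supnorm_ge0.
apply: lee_sum => j _.
by rewrite derive1nZ_holder ?leq_ord//; exact: supnormZ_le.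
Qed.

Lemma holder_norm_ge0 f : (0 <= holder_norm f)%E.
Proof.
apply: adde_ge0; last exact: holder_seminorm_ge0.
by apply: sume_ge0 => j _; exact: supnorm_ge0.
Qed.

Lemma holder_norm_fin f : f \in holder_pred -> holder_norm f \is a fin_num.
Proof.
by move=> /holderP[_ _ foo]; rewrite ge0_fin_numE// holder_norm_ge0.
Qed.

Lemma supnorm_le_holder f : (supnorm f <= holder_norm f)%E.
Proof.
rewrite /holder_norm big_ord_recl/= -addeA leeDl//.
apply: adde_ge0; last exact: holder_seminorm_ge0.
by apply: sume_ge0 => j _; exact: supnorm_ge0.
Qed.

Lemma holder_pred0 : 0 \in holder_pred.
Proof.
have d0 j : (0 : R -> R)^`(j) = 0.
  elim: j => [//|j IH]; rewrite derive1nS IH; apply/funext => x.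
  by rewrite derive1E -[0]/(cst (0 : R)) derive_cst.
have s0 : supnorm (0 : R -> R) = 0%E.
  apply/eqP; rewrite eq_le supnorm_ge0 andbT.
  by apply: supnorm_le => x; rewrite normr0.
apply/holderP; split.
- by move=> j x _; rewrite d0; exact: derivable_cst.
- by rewrite d0; exact: cst_continuous.
- rewrite /holder_norm big1 ?add0e; last by move=> j _; rewrite d0.
  apply: (@le_lt_trans _ _ 0%E); last exact: ltry.
  apply: ge_ereal_sup => _ [h _ <-]; rewrite d0.
  by apply: supnorm_le => x /=; rewrite subrr mul0r normr0.
Qed.

Lemma holder_submod_closed : submod_closed holder_pred.
Proof.
split; first exact: holder_pred0.
move=> c f g Hf Hg.
have Hcf : c *: f \in holder_pred.
  have [df cf nf] := holderP _ Hf.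
  apply/holderP; split.
  - move=> j x jk; rewrite derive1nZ_holder ?(ltnW jk)//.
    by apply: derivableZ; exact: df.
  - rewrite derive1nZ_holder// => x; apply: continuousZr => //.
    exact: cf.
  - apply: le_lt_trans (holder_normZ_le c Hf) _.
    by rewrite lte_mul_pinfty// holder_norm_fin.
have [df cf nf] := holderP _ Hcf; have [dg cg ng] := holderP _ Hg.
apply/holderP; split.
- move=> j x jk; rewrite derive1nD_holder ?(ltnW jk)//.
  by apply: derivableD; [exact: df|exact: dg].
- rewrite derive1nD_holder// => x.
  by apply: continuousD; [exact: cf|exact: cg].
- by apply: le_lt_trans (holder_normD Hcf Hg) _; rewrite lte_add_pinfty.
Qed.

HB.instance Definition _ :=
  GRing.isSubmodClosed.Build R (R -> R) holder_pred holder_submod_closed.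

Record holder := Holder {
  holder_fun :> R -> R;
  _ : holder_fun \in holder_pred }.

HB.instance Definition _ := [isSub for holder_fun].
HB.instance Definition _ := [Choice of holder by <:].
HB.instance Definition _ := [SubChoice_isSubLmodule of holder by <:].

Let hnorm (f : holder) : R := fine (holder_norm f).

Let hnormD (f g : holder) : hnorm (f + g) <= hnorm f + hnorm g.
Proof.
have Hf := valP f; have Hg := valP g.
rewrite /hnorm -fineD ?holder_norm_fin//.
apply: fine_le; [exact: holder_norm_fin (valP (f + g))| |].
  by rewrite fin_numD !holder_norm_fin.
exact: holder_normD.
Qed.

Let hnormZ_le (c : R) (f : holder) : hnorm (c *: f) <= `|c| * hnorm f.
Proof.
have Hf := valP f.
rewrite /hnorm -[`|c|]/(fine `|c|%:E) -fineM ?holder_norm_fin//.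
apply: fine_le; [exact: holder_norm_fin (valP (c *: f))| |].
  by rewrite fin_numM// holder_norm_fin.
exact: holder_normZ_le.
Qed.

Let hnorm0_eq0 (f : holder) : hnorm f = 0 -> f = 0.
Proof.
move=> f0; apply: val_inj; apply/funext => x /=.
have nf0 : holder_norm f = 0%E.
  by rewrite -[LHS]fineK ?holder_norm_fin ?(valP f)// -/(hnorm f) f0.
have := le_trans (supnorm_ub f x) (supnorm_le_holder f).
by rewrite nf0 lee_fin normr_le0 => /eqP.
Qed.

Let hnormZ (c : R) (f : holder) : hnorm (c *: f) = `|c| * hnorm f.
Proof.
have [->|c0] := eqVneq c 0.
  apply/eqP; rewrite eq_le hnormZ_le normr0 mul0r/=.
  by apply: fine_ge0; exact: holder_norm_ge0.
apply/eqP; rewrite eq_le hnormZ_le/=.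
have := hnormZ_le c^-1 (c *: f).
rewrite scalerA mulVf// scale1r normfV => H.
by rewrite -ler_pdivlMl ?normr_gt0.
Qed.

HB.instance Definition _ :=
  Lmodule_isNormed.Build R holder hnormD hnormZ hnorm0_eq0.

Lemma holder_normE (f : holder) : `|f| = fine (holder_norm f).
Proof. by []. Qed.

End HolderNorm.

Arguments holder {R} k theta.

Section SmoothCurves.
Context {R : realType} {V W : normedModType R}.

(* Elements of C^oo((-T,T) : V) are represented by total functions R -> V,
   whose values outside (-T,T) are irrelevant. *)
Definition smooth_curve (T : R) (u : R -> V) : Prop :=
  forall n (t : R), t \in `]- T, T[%R -> derivable (u^`(n)) t 1.

Definition smooth_cvg (T : R) (u : nat -> R -> V) (w : R -> V) : Prop :=
  forall (m : nat) (S : R), S < T ->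
    {uniform `[- S, S], (fun N => (u N)^`(m)) @ \oo --> w^`(m)}.

End SmoothCurves.

Section Analytic.
Context {R : realType} {V W : normedModType R}.

Definition multilinear_curve (T : R) n (P : ('I_n -> V) -> R -> W) : Prop :=
  forall (h : 'I_n -> V) (i : 'I_n) (c : R) (x y : V) (t : R),
    t \in `]- T, T[%R ->
    P (dfwith h i (c *: x + y)) t
      = c *: P (dfwith h i x) t + P (dfwith h i y) t.

(* F, with values in the Frechet space C^oo((-T,T) : W), is the sum on a ball
   centred at a of a series of continuous homogeneous polynomials
   v |-> P n (v, ..., v); for each of the seminorms
   u |-> sup_(|t| <= S) |u^(m)(t)| the norms of the n-linear maps P n are
   O(r^-n), so that the series converges normally on smaller balls. *)
Definition analytic_at (T : R) (F : V -> R -> W) (a : V) : Prop :=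
  exists (r : R) (P : forall n, ('I_n -> V) -> R -> W),
  [/\ 0 < r,
      forall n, multilinear_curve T (P n),
      forall n h, smooth_curve T (P n h),
      forall (m : nat) (S : R), S < T -> exists C : R,
        forall n (h : 'I_n -> V) (t : R), t \in `[- S, S]%R ->
          `|(P n h)^`(m) t| * r ^+ n <= C * \prod_(i < n) `|h i| &
      forall v, `|v| < r ->
        smooth_cvg T (fun N t => \sum_(n < N) P n (fun=> v) t) (F (a + v))].

End Analytic.

Section BBM.
Context {R : realType}.

(* The convolution kernel of d/dx (1 - d^2/dx^2)^-1, that is the derivative of
   the Green function exp(-|x|)/2 of 1 - d^2/dx^2. *)
Definition bbm_kernel (x : R) : R := - 2^-1 * Num.sg x * expR (- `|x|).

Definition convolution (f g : R -> R) (x : R) : R :=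
  Rintegral (@lebesgue_measure R) setT (fun y => f (x - y) * g y).

Variables (k : nat) (theta : R).
Local Notation E := (holder k theta).

(* (1 - d^2/dx^2)^-1 (u_x + u u_x) is read as d/dx (1 - d^2/dx^2)^-1 (u + u^2/2),
   which makes sense for u merely continuous and bounded in x. The derivative in
   t is that of the curve u in the normed space E. *)
Definition bbm_solution (T : R) (u0 : E) (u : R -> E) : Prop :=
  [/\ smooth_curve T u,
      forall t : R, t \in `]- T, T[%R -> forall x : R,
        derive1 u t x
          + convolution bbm_kernel (fun y => u t y + (u t y) ^+ 2 / 2) x = 0 &
      u 0 = u0].

Definition bbm_unique_solution (T : R) (u0 : E) (u : R -> E) : Prop :=
  bbm_solution T u0 u /\
  forall w, bbm_solution T u0 w -> forall t : R, t \in `]- T, T[%R -> w t = u t.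

End BBM.

(* Main.v *)
Require Import Defs.
From HB Require Import structures.
From mathcomp Require Import all_boot all_order all_algebra.
From mathcomp Require Import all_classical all_reals all_analysis.
From mathcomp Require Import measurable_realfun.
From mathcomp Require Import ring lra zify.
Import Order.TTheory GRing.Theory Num.Theory.
Import numFieldNormedType.Exports.

(* If u = K * g and v = (1 - d^2/dx^2)^-1 g then u' = v - g and v' = u, so that
   convolution with K is bounded on C^{k,theta}, which is a Banach algebra up to a
   constant. The problem is thus an ordinary differential equation
   u' = - (A u + B (u, u)) in a Banach space, with A linear and B bilinear, both
   bounded. Its solution is the sum of a power series in t whose coefficients are
   polynomials in the data; expanding them around a point a gives multilinear
   maps, dominated by the coefficients of real polynomials q_n with
   q_n(1) <= D M^n, where D = |a| + 1 and M = al + be D. Both analyticity in the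
   data and convergence for |t| < 1 / M follow. Uniqueness is a Gronwall argument
   in the sup norm, applied pointwise in x. *)

Local Open Scope ring_scope.
Local Open Scope classical_set_scope.

Set Implicit Arguments.
Unset Strict Implicit.
Unset Printing Implicit Defensive.

(** * The convolution kernel *)

Section Calculus.
Context {R : realType}.

(** The kernel gains back the derivative that [u u_x] loses, so the equation is solved in both time
    directions without loss of regularity. A contraction argument would give existence, but
    smoothness in [t] and analyticity in the data would then need separate proofs; one estimate on
    the coefficients of [t^n] gives both. The model of this estimate is the Riccati equation
    [y' = al y + be y^2] with [y(0) = |a| + 1], where [|a|] accounts for the centre and 1 for the
    radius of the ball of data around it; [q_n(1)] thus adds up the contributions of all degrees on
    that ball. The coefficient of [t^n] is a polynomial of degree at most [n + 1] in the data, so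
    its expansion at [a] is a finite identity. Keeping only the degrees below [N] therefore leaves
    every coefficient of [t^k] with [k < N - 1] exact, and the error starts at [t^(N-1)]. On a
    smaller interval this is geometrically small together with each of its [t]-derivatives, which is
    the convergence required in [C^oo((-T,T))]. *)

Lemma is_derive1P (V : normedModType R) (f : R -> V) (x : R) (l : V) :
  derivable f x 1 -> f^`() x = l -> is_derive x 1 f l.
Proof. by move=> df fl; apply: DeriveDef; rewrite -?derive1E. Qed.

Lemma cvg_is_derive1 (V : normedModType R) (f : R -> V) (x : R) (l : V) :
  (h^-1 *: (f (h + x) - f x) @[h --> (0 : R)^'] --> l) -> is_derive x 1 f l.
Proof.
move=> fl.
have fl' : h^-1 *: (f (h *: (1 : R) + x) - f x) @[h --> (0 : R)^'] --> l.
  by under eq_fun do rewrite [_ *: 1]mulr1.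
by apply: DeriveDef; [apply/cvg_ex; exists l|exact: (cvg_lim (@norm_hausdorff _ _) fl')].
Qed.

Lemma is_derive1_cvg (V : normedModType R) (f : R -> V) (x : R) (l : V) :
  is_derive x 1 f l -> h^-1 *: (f (h + x) - f x) @[h --> (0 : R)^'] --> l.
Proof.
move=> [df <-]; rewrite /derive.
by under [X in X @ _ --> _]eq_fun do rewrite -[X in f (X + _)]mulr1.
Qed.

Lemma is_derive1M (f g : R -> R) (x a b : R) :
  is_derive x 1 f a -> is_derive x 1 g b ->
  is_derive x 1 (fun z => f z * g z) (a * g x + f x * b).
Proof. by move=> df dg; have := is_deriveM df dg; rewrite /GRing.scale/= addrC (mulrC (g x)). Qed.

Lemma is_derive_expRN (x : R) : is_derive x 1 (fun z => expR (- z)) (- expR (- x)).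
Proof. by apply: is_derive_eq; rewrite /GRing.scale/= mulrN1. Qed.

End Calculus.

Section Kernel.
Context {R : realType}.
Local Notation mu := (@lebesgue_measure R).
Implicit Types (g : R -> R) (x a M : R).

Lemma continuous_expRN : continuous (fun y : R => expR (- y)).
Proof.
by move=> y; apply: continuous_comp; [exact: continuousN|exact: continuous_expR].
Qed.

Lemma integral_expRN_ray a :
  (\int[mu]_(y in `[a, +oo[) (expR (- y))%:E = (expR (- a))%:E)%E.
Proof.
have D (y : R) : is_derive y 1 (fun z : R => - expR (- z)) (expR (- y)).
  by have := is_deriveN (is_derive_expRN y); rewrite opprK.
rewrite (@ge0_continuous_FTC2y _ (fun y => expR (- y)) (fun y => - expR (- y)) a 0).
- by rewrite sub0e EFinN oppeK.
- by move=> y _; exact: expR_ge0.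
- exact/continuous_subspaceT/continuous_expRN.
- by rewrite -oppr0; apply: cvgN; exact: cvgr_expR.
- by move=> y _; have [] := D y.
- apply: cvgN; apply: cvg_at_right_filter; exact: continuous_expRN.
- by move=> y _; rewrite derive1E; have [] := D y.
Qed.

Lemma integral_expR_ray a :
  (\int[mu]_(y in `]-oo, a]) (expR y)%:E = (expR a)%:E)%E.
Proof.
rewrite -(opprK a) ge0_integration_by_substitutionNy.
- exact: integral_expRN_ray.
- exact/continuous_subspaceT/continuous_expR.
- by move=> y _; exact: expR_ge0.
Qed.

Section BoundedContinuous.
Variables (g : R -> R) (M : R).
Hypotheses (cg : continuous g) (gM : forall x, `|g x| <= M).

Let mg : measurable_fun setT g. Proof. exact: continuous_measurable_fun. Qed.

Lemma ge0_weighted_integrable (D : set R) (w : R -> R) (l : R) : measurable D ->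
  continuous w -> (forall y, 0 <= w y) ->
  (\int[mu]_(y in D) (w y)%:E = l%:E)%E ->
  mu.-integrable D (EFin \o w) /\
  mu.-integrable D (EFin \o (fun y => w y * g y)).
Proof.
move=> mD cw w0 wl.
have mw : measurable_fun D w.
  by apply: measurable_funTS; exact: continuous_measurable_fun.
have iw : mu.-integrable D (EFin \o w).
  apply/integrableP; split; first exact/measurable_EFinP.
  under eq_integral => y _ do rewrite /= ger0_norm//.
  by rewrite wl ltry.
split => //.
apply: (@le_integrable _ _ _ mu _ mD _ (fun y => M%:E * (w y)%:E)%E).
- apply/measurable_EFinP; apply: measurable_funM => //.
  exact: measurable_funTS.
- move=> y _ /=; rewrite lee_fin !normrM mulrC ler_wpM2r//.
  by rewrite (le_trans (gM y))// ler_norm.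
exact: integrableZl.
Qed.

Lemma ge0_weighted_Rintegral_le (D : set R) (w : R -> R) (l : R) : measurable D ->
  continuous w -> (forall y, 0 <= w y) ->
  (\int[mu]_(y in D) (w y)%:E = l%:E)%E ->
  `|\int[mu]_(y in D) (w y * g y)| <= M * l.
Proof.
move=> mD cw w0 wl.
have [iw ig] := ge0_weighted_integrable mD cw w0 wl.
apply: le_trans; first exact: le_normr_Rintegral.
have -> : M * l = \int[mu]_(y in D) (M * w y).
  by rewrite RintegralZl// /Rintegral wl.
apply: le_Rintegral => //; first exact: integrable_norm.
  by rewrite (_ : EFin \o _ = (fun y => M%:E * (EFin \o w) y)%E)//; exact: integrableZl.
by move=> y _; rewrite normrM mulrC (ger0_norm (w0 y)) ler_wpM2r.
Qed.

(** The parts [y <= x] and [y > x] of the convolution of [g] with [exp(-|x|)]. They solve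
    [(1 + d/dx) L = g] and [(1 - d/dx) Q = g], according to the factorization of [1 - d^2/dx^2]; the
    derivatives of both convolutions are combinations of these two equations. *)
Definition left_part x := expR (- x) * \int[mu]_(y in `]-oo, x]) (expR y * g y).
Definition right_part x := expR x * \int[mu]_(y in `]x, +oo[) (expR (- y) * g y).

Let ileft x : mu.-integrable `]-oo, x] (EFin \o (fun y => expR y * g y)).
Proof.
apply: (ge0_weighted_integrable _ _ _ (integral_expR_ray x)).2 => //.
exact: continuous_expR.
Qed.

Let iright x : mu.-integrable `[x, +oo[ (EFin \o (fun y => expR (- y) * g y)).
Proof.
apply: (ge0_weighted_integrable _ _ _ (integral_expRN_ray x)).2 => //.
exact: continuous_expRN.
Qed.

Lemma left_part_bound x : `|left_part x| <= M.
Proof.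
rewrite /left_part normrM (ger0_norm (expR_ge0 _)).
rewrite -(mulr1 M) -(expRxMexpNx_1 x) mulrA [leRHS]mulrC ler_wpM2l ?expR_ge0//.
apply: ge0_weighted_Rintegral_le => //; last exact: integral_expR_ray.
exact: continuous_expR.
Qed.

Lemma right_part_bound x : `|right_part x| <= M.
Proof.
rewrite /right_part normrM (ger0_norm (expR_ge0 _)).
rewrite -(mulr1 M) -(expRxMexpNx_1 x) mulrCA ler_wpM2l ?expR_ge0//.
apply: ge0_weighted_Rintegral_le => //.
  exact: continuous_expRN.
rewrite integral_itv_obnd_cbnd; first exact: integral_expRN_ray.
apply/measurable_EFinP; apply: measurable_funTS.
  by apply: continuous_measurable_fun; exact: continuous_expRN.
Qed.

Lemma is_derive_left_part x : is_derive x 1 left_part (g x - left_part x).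
Proof.
have [d1 d2] := @continuous_FTC1 _ (fun y => expR y * g y) -oo%O x (x + 1)
   (ltac:(lra)) (ileft _) (ltac:(by rewrite ltNyr))
   (@continuousM R R expR g x (@continuous_expR R x) (@cg x)).
have D := is_derive1M (is_derive_expRN x) (is_derive1P d1 d2).
apply: (is_derive_eq D); rewrite /left_part.
by rewrite mulrA (mulrC (expR (- x))) expRxMexpNx_1; ring.
Qed.

Lemma is_derive_right_part x : is_derive x 1 right_part (right_part x - g x).
Proof.
pose h y := expR (- y) * g y.
have ih (a : R) : mu.-integrable `[a, +oo[ (EFin \o h) by exact: iright.
(* The integral is differentiated in its upper end point, so the ray from [z] is written as the
   fixed ray from [a] minus the segment from [a] to [z]. Any [a < x] would do. *)
pose a := x - 1; have ax : a < x by rewrite /a; lra.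
have [d1 d2] := @continuous_FTC1_closed _ h a x (x + 1)
   (ltac:(lra)) (ltac:(apply: integrableS (ih a) => //; exact: subset_itvl))
   ax
   (@continuousM R R (fun y => expR (- y)) g x (@continuous_expRN x) (@cg x)).
have D := is_derive1P d1 d2.
pose J := \int[mu]_(y in `[a, +oo[) h y.
have DJ := is_derive1M (is_derive_expR x) (is_deriveB (is_derive_cst J x 1) D).
have JE (z : R) : a < z ->
    J - \int[mu]_(y in `[a, z]) h y = \int[mu]_(y in `]z, +oo[) h y.
  move=> az; apply: Rintegral_itvB; first exact: ih.
    by rewrite bnd_simp ltW.
  by rewrite bnd_simp.
apply: (@near_eq_is_derive _ _ _ _ _ _ _ _ _ (is_derive_eq DJ _)).
  near=> z; congr (_ * _); apply: JE.
  by near: z; exact: lt_nbhsr.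
rewrite sub0r mulrN /h mulrA expRxMexpNx_1 mul1r; congr (_ * _ - _).
exact: JE.
Unshelve. all: by end_near. Qed.


Lemma integral_expRN_abs x :
  (\int[mu]_y (expR (- `|x - y|))%:E = 2%:E)%E.
Proof.
have c : continuous (fun y => expR (- `|x - y|)).
  move=> y; apply: (@continuous_comp _ _ _ (fun y => `|x - y|) (fun y => expR (- y)) y).
    apply: (@continuous_comp _ _ _ (fun y => x - y) Num.norm y); last exact: norm_continuous.
    by apply: continuousB => //; exact: cst_continuous.
  exact: continuous_expRN.
have m (D : set R) : measurable_fun D (fun y => (expR (- `|x - y|))%:E).
  by apply/measurable_EFinP/measurable_funTS; exact: continuous_measurable_fun.
rewrite -(setUv `]-oo, x]) setCitvl ge0_integral_setU//=; last 2 first.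
  exact: m.
  by apply/disj_setPS => y [/=]; rewrite !in_itv/= andbT => yx; rewrite ltNge yx.
have E1 : (\int[mu]_(y in `]-oo, x]) (expR (- `|x - y|))%:E = 1%:E)%E.
  transitivity (\int[mu]_(y in `]-oo, x]) ((expR (- x))%:E * (expR y)%:E))%E; last first.
    rewrite ge0_integralZl//=.
    by rewrite integral_expR_ray -EFinM mulrC expRxMexpNx_1.
    apply/measurable_EFinP; apply: measurable_funTS.
  by apply: continuous_measurable_fun; exact: continuous_expR.
  apply: eq_integral => y; rewrite inE/= in_itv/= => yx; congr (_%:E).
  by rewrite ger0_norm ?subr_ge0// opprB addrC expRD.
have E2 : (\int[mu]_(y in `]x, +oo[) (expR (- `|x - y|))%:E = 1%:E)%E.
  rewrite integral_itv_obnd_cbnd//.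
  transitivity (\int[mu]_(y in `[x, +oo[) ((expR x)%:E * (expR (- y))%:E))%E; last first.
    rewrite ge0_integralZl//=.
    by rewrite integral_expRN_ray -EFinM expRxMexpNx_1.
    apply/measurable_EFinP; apply: measurable_funTS.
  by apply: continuous_measurable_fun; exact: continuous_expRN.
  apply: eq_integral => y; rewrite inE/= in_itv/= andbT => yx; congr (_%:E).
  by rewrite ler0_norm ?subr_le0// opprK expRD.
by rewrite E1 E2 -EFinD.
Qed.

Lemma bbm_kernel_integrable x :
  mu.-integrable setT (EFin \o (fun y => bbm_kernel (x - y) * g y)).
Proof.
have c : continuous (fun y => expR (- `|x - y|)).
  move=> y; apply: (@continuous_comp _ _ _ (fun y => `|x - y|) (fun y => expR (- y)) y).
    apply: (@continuous_comp _ _ _ (fun y => x - y) Num.norm y); last exact: norm_continuous.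
    by apply: continuousB => //; exact: cst_continuous.
  exact: continuous_expRN.
have mB : measurable_fun setT (fun y : R => x - y).
  by apply: measurable_funB.
have mk : measurable_fun setT (fun y : R => bbm_kernel (x - y)).
  apply: measurable_funM.
    apply: measurable_funM => //; apply: (measurableT_comp _ mB).
    (* The sign is measurable as a difference of indicators of open half-lines, both of which vanish
       at 0. *)
    rewrite (_ : Num.sg = fun z : R => \1_(`]0, +oo[) z - \1_(`]-oo, 0[) z).
      by apply: measurable_funB; exact: measurable_indic.
    apply/funext => z; rewrite !indicE; have [z0|z0|->] := ltgtP z 0.
    - rewrite ltr0_sg// memNset ?mem_set ?sub0r//= in_itv/= ?andbT//.
      by rewrite ltNge (ltW z0).
    - rewrite gtr0_sg// mem_set ?memNset ?subr0//= in_itv/= ?andbT//.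
      by rewrite ltNge (ltW z0).
    - by rewrite sgr0 !memNset ?subr0//= in_itv/= ltxx.
  exact: continuous_measurable_fun.
have [_ i] := ge0_weighted_integrable measurableT c
   (fun y => expR_ge0 _) (integral_expRN_abs x).
apply: (@le_integrable _ _ _ mu _ measurableT _ _ _ _ i).
  by apply/measurable_EFinP; apply: measurable_funM.
move=> y _ /=; rewrite lee_fin normrM [leRHS]normrM ler_wpM2r// normrM ler_piMl//.
rewrite normrM normrN normfV (ger0_norm (ler0n R 2)) normr_sg.
by case: (_ == 0); rewrite /= ?mulr0 ?mulr1// ?ler01// invf_le1// ler1n.
Qed.

Lemma convolution_bbm_kernelE x :
  convolution bbm_kernel g x = 2^-1 * (right_part x - left_part x).
Proof.
have ik := bbm_kernel_integrable x.
have iS (D : set R) : measurable D ->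
    mu.-integrable D (EFin \o (fun y => bbm_kernel (x - y) * g y)).
  by move=> mD; exact: integrableS ik.
rewrite /convolution -(setUv `]-oo, x]) setCitvl Rintegral_setU//=; last 2 first.
  by rewrite -setCitvl setUv.
  by apply/disj_setPS => y [/=]; rewrite !in_itv/= andbT => yx; rewrite ltNge yx.
(* the kernel vanishes at 0, whence the detour through the open half-line *)
rewrite -Rintegral_itv_bndo_bndc; last exact: iS.
rewrite addrC mulrBr; congr (_ + _).
  rewrite /right_part mulrA -RintegralZl//; last first.
    by apply: integrableS (iright x) => //; by apply: subset_itvr; rewrite bnd_simp.
  apply: eq_Rintegral => y; rewrite inE/= in_itv/= andbT => xy.
  rewrite /bbm_kernel ltr0_sg ?subr_lt0// ltr0_norm ?subr_lt0//.
  by rewrite opprK expRD; ring.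
rewrite /left_part -mulrN -mulNr mulrA -Rintegral_itv_bndo_bndc; last first.
  by apply: integrableS (ileft x) => //; apply: subset_itvl; rewrite bnd_simp.
rewrite -RintegralZl//; last first.
  by apply: integrableS (ileft x) => //; apply: subset_itvl; rewrite bnd_simp.
apply: eq_Rintegral => y; rewrite inE/= in_itv/= => yx.
rewrite /bbm_kernel gtr0_sg ?subr_gt0// gtr0_norm ?subr_gt0//.
by rewrite opprB addrC expRD; ring.
Qed.

(** This is $(1-\partial_x^2)^{-1}g$, the convolution of [g] with [exp(-|x|)/2], put together from
    its two halves. *)
Definition green_convolution x := 2^-1 * (right_part x + left_part x).

Lemma convolution_bbm_kernel_bound x : `|convolution bbm_kernel g x| <= M.
Proof.
rewrite convolution_bbm_kernelE normrM ger0_norm ?invr_ge0//.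
have := ler_normB (right_part x) (left_part x).
by have := left_part_bound x; have := right_part_bound x; lra.
Qed.

Lemma green_convolution_bound x : `|green_convolution x| <= M.
Proof.
rewrite normrM ger0_norm ?invr_ge0//.
have := ler_normD (right_part x) (left_part x).
by have := left_part_bound x; have := right_part_bound x; lra.
Qed.

Lemma is_derive_convolution_bbm_kernel x :
  is_derive x 1 (convolution bbm_kernel g) (green_convolution x - g x).
Proof.
have -> : convolution bbm_kernel g = 2^-1 \*: (right_part - left_part).
  by apply/funext => y; rewrite convolution_bbm_kernelE.
apply: (is_derive_eq (is_deriveZ _ (is_deriveB (is_derive_right_part x) (is_derive_left_part x)))).
by rewrite /green_convolution /GRing.scale/=; field.
Qed.

Lemma is_derive_green_convolution x :
  is_derive x 1 green_convolution (convolution bbm_kernel g x).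
Proof.
rewrite convolution_bbm_kernelE.
apply: (is_derive_eq (is_deriveZ _ (is_deriveD (is_derive_right_part x) (is_derive_left_part x)))).
by rewrite /GRing.scale/=; field.
Qed.

End BoundedContinuous.

Lemma convolution_bbm_kernel_linear (c : R) (f g : R -> R) (M N : R) :
  continuous f -> (forall x, `|f x| <= M) ->
  continuous g -> (forall x, `|g x| <= N) ->
  convolution bbm_kernel (fun x => c * f x + g x) =
  (fun x => c * convolution bbm_kernel f x + convolution bbm_kernel g x).
Proof.
move=> cf fM cg gN; apply/funext => x; rewrite /convolution.
have jf := bbm_kernel_integrable cf fM x; have jg := bbm_kernel_integrable cg gN x.
rewrite -RintegralZl// -RintegralD//=.
- by apply: eq_Rintegral => y _; rewrite mulrDr mulrCA.
- rewrite (_ : EFin \o _ = fun y => (c%:E * (EFin \o (fun y => bbm_kernel (x - y) * f y)%R) y)%E)//.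
  exact: integrableZl.
Qed.

End Kernel.

(** * The spaces C^{k,theta} *)

Section HolderBounds.
Context {R : realType}.
Variable theta : R.
Hypothesis theta01 : 0 <= theta <= 1.
Implicit Types (f g : R -> R) (M N : R).

(** One constant [M] serves all the terms of the norm. This is equivalent to a bound on the norm up
    to a factor [k + 2], but it is made of pointwise real inequalities and unfolds one derivative at
    a time, as the inductions on [k] require. *)
Fixpoint holder_bound k f M : Prop :=
  if k is k'.+1 then
    [/\ forall x, derivable f x 1, forall x, `|f x| <= M & holder_bound k' f^`() M]
  else [/\ continuous f, forall x, `|f x| <= M &
           forall x h, h != 0 -> `|f (x + h) - f x| <= M * `|h| `^ theta].

Lemma holder_bound_sup k f M : holder_bound k f M -> forall x, `|f x| <= M.
Proof. by case: k => [|k] []. Qed.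

Lemma holder_bound_ge0 k f M : holder_bound k f M -> 0 <= M.
Proof. by move=> /holder_bound_sup /(_ 0); apply: le_trans. Qed.

Lemma holder_bound_continuous k f M : holder_bound k f M -> continuous f.
Proof.
case: k => [|k] [] // df _ _ x.
by apply: differentiable_continuous; apply/derivable1_diffP.
Qed.

Lemma holder_boundW k f M N : M <= N -> holder_bound k f M -> holder_bound k f N.
Proof.
move=> MN; elim: k f => [|k IH] f [] /=.
  move=> cf fM hf; split => // [x|x h h0]; first exact: le_trans MN.
  by apply: le_trans (hf x h h0) _; rewrite ler_wpM2r// powR_ge0.
by move=> df fM hf; split => // [x|]; [exact: le_trans MN|exact: IH].
Qed.

Lemma holder_bound_lin k (c : R) f g M N : holder_bound k f M -> holder_bound k g N ->
  holder_bound k (fun x => c * f x + g x) (`|c| * M + N).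
Proof.
elim: k f g => [|k IH] f g [].
  move=> cf fM hf [cg gN hg]; split => [x|x|x h h0].
  - apply: (@continuousD _ _ _ (fun x => c * f x) g); last exact: cg.
    by apply: (@continuousM _ _ (cst c) f); [exact: cst_continuous|exact: cf].
  - by apply: le_trans (ler_normD _ _) _; rewrite lerD// normrM ler_wpM2l.
  - rewrite opprD addrACA -mulrBr mulrDl.
    apply: le_trans (ler_normD _ _) _; rewrite lerD ?hg//.
    by rewrite normrM -mulrA ler_wpM2l// hf.
move=> df fM hf [dg gN hg]; split.
- move=> x; apply: (@derivableD _ _ _ (c \*: f) g) => //.
  exact: derivableZ.
- by move=> x; apply: le_trans (ler_normD _ _) _; rewrite lerD// normrM ler_wpM2l.
- rewrite (_ : derive1 _ = (fun x => c * derive1 f x + derive1 g x)); first exact: IH.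
  apply/funext => x; rewrite !derive1E.
  by rewrite (@deriveD _ _ _ (c \*: f) g) ?deriveZ//; exact: derivableZ.
Qed.

Lemma holder_boundD k f g M N : holder_bound k f M -> holder_bound k g N ->
  holder_bound k (fun x => f x + g x) (M + N).
Proof.
move=> hf hg; have := holder_bound_lin 1 hf hg.
by rewrite normr1 mul1r; under eq_fun do rewrite mul1r.
Qed.

Lemma holder_boundB k f g M N : holder_bound k f M -> holder_bound k g N ->
  holder_bound k (fun x => f x - g x) (M + N).
Proof.
move=> hf hg; have := holder_bound_lin (-1) hg hf.
rewrite normrN normr1 mul1r addrC.
by under eq_fun do rewrite mulN1r addrC.
Qed.

Lemma ler_dist_derivative f (x y : R) M : (forall x, derivable f x 1) ->
  (forall x, `|f^`() x| <= M) -> `|f y - f x| <= M * `|y - x|.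
Proof.
move=> df f'M.
have c : continuous f.
  by move=> z; apply: differentiable_continuous; apply/derivable1_diffP.
have D (z : R) : is_derive z 1 f (derive1 f z) by exact: is_derive1P.
wlog xy : x y / x <= y.
  move=> H; have [/H//|/ltW /H] := leP x y.
  by rewrite distrC (distrC x).
have [z _ ->] := MVT_segment xy (fun z _ => D z) (continuous_subspaceT c).
by rewrite normrM ler_wpM2r.
Qed.

(** For [|h| <= 1] the mean value inequality applies and [|h| <= |h|^theta] since [theta <= 1]; for
    [|h| >= 1] the increment is at most [2 M] and [|h|^theta >= 1] since [theta >= 0]. *)
Lemma holder_bound_interpolation f M : (forall x, derivable f x 1) ->
  (forall x, `|f x| <= M) -> (forall x, `|f^`() x| <= M) ->
  holder_bound 0 f (2 * M).
Proof.
move=> df fM f'M; have M0 : 0 <= M by apply: le_trans (fM 0).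
split.
- by move=> x; apply: differentiable_continuous; apply/derivable1_diffP.
- by move=> x; apply: le_trans (fM x) _; rewrite ler_peMl// ler1n.
move=> x h h0; have [h1|/ltW h1] := leP `|h| 1.
  apply: (le_trans (ler_dist_derivative _ _ df f'M)).
  rewrite addrAC subrr add0r; apply: ler_pM => //; first by rewrite ler_peMl// ler1n.
  by apply: ger1_powR; [rewrite normr_gt0 h0|case/andP: theta01].
apply: (le_trans (ler_normB _ _)).
apply: (@le_trans _ _ (2 * M)); first by rewrite mulr_natl mulr2n lerD.
rewrite ler_peMr ?mulr_ge0//.
by rewrite -(powRr0 `|h|); apply: ler_powR => //; case/andP: theta01.
Qed.

Lemma holder_bound_succ k f M : holder_bound k.+1 f M -> holder_bound k f (2 * M).
Proof.
elim: k f => [|k IH] f [df fM hf].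
  by apply: holder_bound_interpolation => //; case: hf.
split => //; last exact: IH.
move=> x; apply: le_trans (fM x) _; rewrite ler_peMl ?ler1n//.
exact: le_trans (fM 0).
Qed.

Lemma holder_boundM k : exists2 C, 0 <= C & forall f g M N,
  holder_bound k f M -> holder_bound k g N ->
  holder_bound k (fun x => f x * g x) (C * (M * N)).
Proof.
elim: k => [|k [C C0 IH]].
  exists 2 => // f g M N hf hg.
  have M0 := holder_bound_ge0 hf; have N0 := holder_bound_ge0 hg.
  case: hf hg => cf fM hf [cg gN hg]; split.
  - by move=> x; apply: (@continuousM _ _ f g); [exact: cf|exact: cg].
  - move=> x; rewrite normrM (@le_trans _ _ (M * N))//; first exact: ler_pM.
    by rewrite ler_peMl ?mulr_ge0// ler1n.
  - move=> x h h0.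
    have -> : f (x + h) * g (x + h) - f x * g x =
      f (x + h) * (g (x + h) - g x) + (f (x + h) - f x) * g x by ring.
    apply: (le_trans (ler_normD _ _)); rewrite !normrM.
    have -> : 2 * (M * N) * `|h| `^ theta =
      M * (N * `|h| `^ theta) + M * `|h| `^ theta * N by ring.
    by apply: lerD; apply: ler_pM => //; [exact: hg|exact: hf].
(* In [f' g + f g'] the undifferentiated factor is used at order [k], where its bound doubles: [2 C]
   for each term. The 1 is for the supremum of the product itself. *)
exists (4 * C + 1); first by rewrite addr_ge0 ?mulr_ge0.
move=> f g M N hf hg; have M0 := holder_bound_ge0 hf; have N0 := holder_bound_ge0 hg.
have hf2 := holder_bound_succ hf; have hg2 := holder_bound_succ hg.
case: hf hg => df fM hf [dg gN hg]; split.
- by move=> x; exact: (@derivableM _ _ f g).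
- move=> x; rewrite normrM (@le_trans _ _ (M * N))//; first exact: ler_pM.
  by rewrite ler_peMl ?mulr_ge0// lerDr mulr_ge0.
- have -> : derive1 (fun x => f x * g x) =
     (fun x => derive1 f x * g x + f x * derive1 g x).
    apply/funext => x; rewrite !derive1E (@deriveM _ _ f g)//.
    by rewrite /GRing.scale/= addrC [g x * _]mulrC.
  have := holder_boundD (IH _ _ _ _ hf hg2) (IH _ _ _ _ hf2 hg).
  apply: holder_boundW.
  have -> : C * (M * (2 * N)) + C * (2 * M * N) = 4 * C * (M * N) by ring.
  by rewrite ler_wpM2r ?mulr_ge0// lerDl.
Qed.

(* With [u = K * g] and [v = (1 - d^2/dx^2)^-1 g], one has [u' = v - g] and
   [v' = u]: each derivative in the norm is traded for a lower order bound. *)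
Lemma holder_bound_convolution k : exists2 C, 0 <= C & forall g M,
  holder_bound k g M ->
  holder_bound k (convolution bbm_kernel g) (C * M) /\
  holder_bound k (green_convolution g) (C * M).
Proof.
have calc g M : continuous g -> (forall x, `|g x| <= M) ->
    [/\ (forall x, derivable (convolution bbm_kernel g) x 1),
       (forall x, derivable (green_convolution g) x 1),
       derive1 (convolution bbm_kernel g) = (fun x => green_convolution g x - g x) &
       derive1 (green_convolution g) = convolution bbm_kernel g].
  move=> cg gM; split.
  - by move=> x; have [] := is_derive_convolution_bbm_kernel cg gM x.
  - by move=> x; have [] := is_derive_green_convolution cg gM x.
  - apply/funext => x; rewrite derive1E.
    by have [] := is_derive_convolution_bbm_kernel cg gM x.
  - by apply/funext => x; rewrite derive1E; have [] := is_derive_green_convolution cg gM x.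
elim: k => [|k [C C0 IH]].
  exists 4 => // g M hg; have M0 := holder_bound_ge0 hg.
  case: hg => cg gM hg; have [du dv u'E v'E] := calc _ _ cg gM.
  have uM := convolution_bbm_kernel_bound cg gM.
  have vM := green_convolution_bound cg gM.
  have M2 : M <= 2 * M by rewrite ler_peMl// ler1n.
  have -> : 4 * M = 2 * (2 * M) by ring.
  split; apply: holder_bound_interpolation => //.
  - by move=> x; apply: le_trans M2.
  - move=> x; rewrite u'E; apply: (le_trans (ler_normB _ _)).
    by rewrite mulr_natl mulr2n lerD.
  - by move=> x; apply: le_trans M2.
  - by move=> x; rewrite v'E; apply: le_trans M2.
(* The derivative [v - g] is estimated at order [k], where [g] has the bound [2 M]: this gives
   [2 C M] for [v] and [2 M] for [g]. *)
exists (2 * C + 2); first by rewrite addr_ge0 ?mulr_ge0.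
move=> g M hg; have M0 := holder_bound_ge0 hg.
have gM := holder_bound_sup hg; have cg := holder_bound_continuous hg.
have hg2 := holder_bound_succ hg.
have [hu hv] := IH _ _ hg2.
have [du dv u'E v'E] := calc _ _ cg gM.
have MC : M <= (2 * C + 2) * M by rewrite ler_peMl// (le_trans (ler1n _ 2))// lerDr mulr_ge0.
split; split => //.
- by move=> x; rewrite (le_trans (convolution_bbm_kernel_bound cg gM x)).
- rewrite u'E; apply: holder_boundW (holder_boundB hv hg2); lra.
- by move=> x; rewrite (le_trans (green_convolution_bound cg gM x)).
- by rewrite v'E; apply: holder_boundW hu; lra.
Qed.

Lemma holder_normS k f :
  holder_norm k.+1 theta f = (supnorm f + holder_norm k theta f^`())%E.
Proof.
rewrite /holder_norm big_ord_recl/= -addeA; congr (_ + (_ + _))%E.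
  by apply: eq_bigr => i _; rewrite -derive1Sn.
by rewrite -derive1Sn.
Qed.

Lemma holder_pred_bound k f M : f \in holder_pred k theta ->
  (holder_norm k theta f <= M%:E)%E -> holder_bound k f M.
Proof.
elim: k f => [|k IH] f /holderP[df cf _].
  rewrite /holder_norm big_ord_recl big_ord0 adde0 derive1n0 => nf.
  split=> // [x|x h h0].
    rewrite -lee_fin; apply: le_trans (supnorm_ub f x) _; apply: le_trans nf.
    by rewrite leeDl// holder_seminorm_ge0.
  have hp : 0 < `|h| `^ theta by apply: powR_gt0; rewrite normr_gt0.
  rewrite -ler_pdivrMr// -[X in _ / X](ger0_norm (ltW hp)) -normf_div -lee_fin.
  apply: le_trans nf; apply: (@le_trans _ _ (holder_seminorm theta f)).
    apply: le_trans (supnorm_ub (fun x => (f (x + h) - f x) / `|h| `^ theta) x) _.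
    by apply: ereal_sup_ubound; exists h.
  by rewrite leeDr// supnorm_ge0.
rewrite holder_normS => nf; split.
- by move=> x; exact: (df 0%N).
- move=> x; rewrite -lee_fin; apply: le_trans (supnorm_ub f x) _.
  by apply: le_trans nf; rewrite leeDl// holder_norm_ge0.
- have nf' : (holder_norm k theta f^`() <= M%:E)%E.
    by apply: le_trans nf; rewrite leeDr// supnorm_ge0.
  apply: IH => //; apply/holderP; split.
  + by move=> j x jk; rewrite -derive1Sn; exact: df.
  + by rewrite -derive1Sn.
  + by rewrite (le_lt_trans nf')// ltry.
Qed.

(** The norm has [k + 1] suprema and one seminorm, each at most [M]. *)
Lemma holder_bound_norm k f M : holder_bound k f M ->
  (holder_norm k theta f <= ((k.+2)%:R * M)%:E)%E.
Proof.
elim: k f => [|k IH] f.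
  move=> [cf fM hf]; rewrite /holder_norm big_ord_recl big_ord0 adde0 derive1n0.
  rewrite mulr_natl mulr2n EFinD leeD//; first by apply: supnorm_le => x; rewrite lee_fin.
  apply: ge_ereal_sup => _ [h /= h0 <-]; apply: supnorm_le => x.
  have hp : 0 < `|h| `^ theta by apply: powR_gt0; rewrite normr_gt0.
  by rewrite lee_fin normf_div (ger0_norm (ltW hp)) ler_pdivrMr// hf.
move=> [df fM hf]; rewrite holder_normS -natr1 mulrDl mul1r EFinD addeC leeD ?IH//.
by apply: supnorm_le => x; rewrite lee_fin.
Qed.

Lemma holder_bound_pred k f M : holder_bound k f M -> f \in holder_pred k theta.
Proof.
move=> hf; have nf := le_lt_trans (holder_bound_norm hf) (ltry _).
apply/holderP; split => //; elim: k f hf {nf} => [|k IH] f //.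
- by move=> [df fM hf] [|j] x jk; [exact: df|rewrite derive1Sn; exact: IH].
- by case.
- by move=> [_ _ hf]; rewrite derive1Sn; exact: IH.
Qed.

(** * Completeness of $C^{k,\theta}$ *)

Section Limit.
Context {I : Type} {F : set_system I} {FF : ProperFilter F}.
Implicit Types u : I -> R -> R.

Lemma cvg_ler_in (h : I -> R) (l M : R) (A : set I) :
  h i @[i --> F] --> l -> F A -> (forall i, A i -> h i <= M) -> l <= M.
Proof.
move=> hl FA hM; rewrite -(cvg_lim (@Rhausdorff R) hl); apply: limr_le.
  by apply/cvg_ex; exists l.
exact: filterS FA.
Qed.

Lemma uniform_cauchy_cvg u :
  (forall e, 0 < e -> exists2 A, F A & forall i j x, A i -> A j -> `|u i x - u j x| <= e) ->
  exists g : R -> R, forall x, u i x @[i --> F] --> g x.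
Proof.
move=> H; exists (fun x => lim (u i x @[i --> F])) => x.
apply/cauchy_cvgP/cauchyP => e e0.
have e20 : 0 < e / 2 by rewrite divr_gt0.
have [A FA AA] := H _ e20; have [i Ai] := filter_ex FA.
exists (u i x); change (F [set j | ball (u i x) e (u j x)]).
apply: filterS FA => j Aj; rewrite /= /ball/=.
by rewrite (le_lt_trans (AA i j x Ai Aj))// ltr_pdivrMr// ltr_pMr// ltr1n.
Qed.

(** The bounds are non-strict, hence survive pointwise limits in [j]. At order [k + 1] the induction
    gives a limit [g1] of the derivatives, and [g1] is shown to be the derivative of the pointwise
    limit [g]. A filter replaces sequences because completeness is about Cauchy filters. *)
Lemma holder_bound_limit k u :
  (forall i, exists M, holder_bound k (u i) M) ->
  (forall e, 0 < e -> exists2 A, F A & forall i j, A i -> A j ->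
     holder_bound k (fun x => u i x - u j x) e) ->
  exists g, forall e, 0 < e -> exists2 A, F A & forall i, A i ->
     holder_bound k (fun x => u i x - g x) e.
Proof.
elim: k u => [|k IH] u uM uu.
  have [|g ug] := @uniform_cauchy_cvg u.
    move=> e e0; have [A FA AA] := uu e e0.
    by exists A => // i j x Ai Aj; exact: (holder_bound_sup (AA i j Ai Aj)).
  have ub i e A : F A -> (forall j, A j -> holder_bound 0 (fun x => u i x - u j x) e) ->
      forall x, `|u i x - g x| <= e.
    move=> FA AA x; have /= := @cvg_ler_in (fun j => `|u i x - u j x|) _ e A _ FA; apply.
      by apply: cvg_norm; apply: cvgB (ug x); exact: cvg_cst.
    by move=> j Aj; exact: (holder_bound_sup (AA j Aj)).
  have cg : continuous g.
    move=> x; apply/cvgrPdist_le => e e0.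
    have e30 : 0 < e / 3 by rewrite divr_gt0.
    have [A FA AA] := uu _ e30; have [i Ai] := filter_ex FA.
    have [M /holder_bound_continuous cu] := uM i.
    have := ub i _ A FA (fun j Aj => AA i j Ai Aj) => ugi.
    have /cvgrPdist_le/(_ _ e30) := cu x; apply: filterS => y uxy.
    have -> : g x - g y = (u i x - u i y) - (u i x - g x) + (u i y - g y) by ring.
    apply: (le_trans (ler_normD _ _)).
    have := ler_normB (u i x - u i y) (u i x - g x).
    by have := ugi x; have := ugi y; lra.
  exists g => e e0; have [A FA AA] := uu _ e0; exists A => // i Ai.
  have [M /holder_bound_continuous cu] := uM i.
  split.
  - by move=> x; apply: (@continuousB _ _ _ (u i) g); [exact: cu|exact: cg].
  - by apply: (ub i e A FA) => j Aj; exact: AA.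
  - move=> x h h0.
    have /= := @cvg_ler_in (fun j => `|u i (x + h) - u j (x + h) - (u i x - u j x)|)
      _ (e * `|h| `^ theta) A _ FA; apply.
      apply: cvg_norm; apply: cvgB; apply: cvgB.
      + exact: cvg_cst.
      + exact: ug.
      + exact: cvg_cst.
      + exact: ug.
    by move=> j Aj; have [_ _ hij] := AA i j Ai Aj; exact: hij.
have du i x : derivable (u i) x 1 by have [M []] := uM i.
have u'E i j : derive1 (fun x => u i x - u j x) =
    (fun x => derive1 (u i) x - derive1 (u j) x).
  by apply/funext => x; rewrite !derive1E (@deriveB _ _ _ (u i) (u j)).
have [||g1 ug1] := IH (fun i => derive1 (u i)).
- by move=> i; have [M [_ _ hM]] := uM i; exists M.
- move=> e e0; have [A FA AA] := uu e e0; exists A => // i j Ai Aj.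
  by rewrite -u'E; have [] := AA i j Ai Aj.
have [|g ug] := @uniform_cauchy_cvg u.
  move=> e e0; have [A FA AA] := uu e e0.
  by exists A => // i j x Ai Aj; exact: (holder_bound_sup (AA i j Ai Aj)).
have dg (x : R) : is_derive x 1 g (g1 x).
  apply: cvg_is_derive1; apply/cvgrPdist_le => e e0.
  have e30 : 0 < e / 3 by rewrite divr_gt0.
  have [A FA AA] := uu _ e30; have [B FB BB] := ug1 _ e30.
  have [i [Ai Bi]] := filter_ex (filterI FA FB).
  have /is_derive1_cvg/cvgrPdist_le/(_ _ e30) := is_derive1P (du i x) erefl.
  have nz := @nbhs_dnbhs_neq R 0.
  apply: filterS2 nz => h h0 uh.
  have g1i : `|derive1 (u i) x - g1 x| <= e / 3 := holder_bound_sup (BB i Bi) x.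
  (* The mean value inequality for [u i - u j] has a constant independent of [j]; in the limit, the
     difference quotients of [u i] and [g] are close uniformly in [h]. *)
  have gi : `|u i (h + x) - g (h + x) - (u i x - g x)| <= e / 3 * `|h|.
    have /= := @cvg_ler_in (fun j => `|u i (h + x) - u j (h + x) - (u i x - u j x)|)
      _ (e / 3 * `|h|) A _ FA; apply.
      apply: cvg_norm; apply: cvgB; apply: cvgB.
      + exact: cvg_cst.
      + exact: ug.
      + exact: cvg_cst.
      + exact: ug.
    move=> j Aj; have [dij _ hij] := AA i j Ai Aj.
    have := ler_dist_derivative x (h + x) dij (holder_bound_sup hij).
    by rewrite addrK.
  have {}gi : `|h^-1 * (u i (h + x) - g (h + x) - (u i x - g x))| <= e / 3.
    by rewrite normrM normfV mulrC ler_pdivrMr// normr_gt0.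
  have -> : g1 x - h^-1 *: (g (h + x) - g x) =
     (derive1 (u i) x - h^-1 * (u i (h + x) - u i x)) - (derive1 (u i) x - g1 x)
     + h^-1 * (u i (h + x) - g (h + x) - (u i x - g x)) by rewrite /GRing.scale/=; ring.
  apply: (le_trans (ler_normD _ _)).
  have := ler_normB (derive1 (u i) x - h^-1 * (u i (h + x) - u i x)) (derive1 (u i) x - g1 x).
  by move: uh; rewrite /GRing.scale/=; lra.
exists g => e e0; have [A FA AA] := uu _ e0; have [B FB BB] := ug1 _ e0.
exists (A `&` B); first exact: filterI.
move=> i [Ai Bi]; split.
- by move=> x; apply: (@derivableB _ _ _ (u i) g) => //; have [] := dg x.
- move=> x; have /= := @cvg_ler_in (fun j => `|u i x - u j x|) _ e A _ FA; apply.
    by apply: cvg_norm; apply: cvgB (ug x); exact: cvg_cst.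
  by move=> j Aj; exact: (holder_bound_sup (AA i j Ai Aj)).
- have -> : derive1 (fun x => u i x - g x) = (fun x => derive1 (u i) x - g1 x).
    apply/funext => x; have [dgx gx] := dg x.
    by rewrite !derive1E (@deriveB _ _ _ (u i) g)// gx.
  exact: BB.
Qed.

End Limit.

Lemma holder_bound_fun k (f : holder k theta) : holder_bound k f `|f|.
Proof.
have Hf := valP f; apply: holder_pred_bound => //.
by rewrite holder_normE fineK// holder_norm_fin.
Qed.

Lemma holder_bound_norm_le k (f : holder k theta) M :
  holder_bound k f M -> `|f| <= k.+2%:R * M.
Proof.
move=> /holder_bound_norm hf; have Hf := valP f.
by rewrite holder_normE -lee_fin fineK// holder_norm_fin.
Qed.

Lemma holder_complete k (F : set_system (holder k theta)) :
  ProperFilter F -> cauchy F -> cvg F.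
Proof.
move=> FF Fc.
have [||g Fg] := @holder_bound_limit (holder k theta) F FF k (fun f : holder k theta => f : R -> R).
- by move=> f; exists `|f|; exact: holder_bound_fun.
- move=> e e0; have e20 : 0 < e / 2 by rewrite divr_gt0.
  have /cauchyP/(_ _ e20)[f Ff] := Fc.
  exists (ball f (e / 2)) => // a b fa fb.
  apply: holder_boundW (holder_bound_fun (a - b)).
  move: fa fb; rewrite -!ball_normE/= => fa fb.
  have -> : a - b = (f - b) - (f - a) by rewrite opprB [RHS]addrC subrKA.
  by apply: (le_trans (ler_normB _ _)); lra.
have [f hf] : exists M, holder_bound k g M.
  have [A FA AA] := Fg 1 ltr01; have [f Af] := filter_ex FA.
  have := holder_boundB (holder_bound_fun f) (AA f Af).
  by under eq_fun do rewrite subKr; move=> ?; eexists; eassumption.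
pose G : holder k theta := Holder (holder_bound_pred hf).
apply/cvg_ex; exists G; apply/cvgrPdist_le => e e0.
(* The factor [k + 2] is lost in passing from a common bound to the norm. *)
have e0' : 0 < e / k.+2%:R by rewrite divr_gt0.
have [A FA AA] := Fg _ e0'; apply: filterS FA => a Aa; rewrite distrC.
have /holder_bound_norm_le : holder_bound k (a - G) (e / k.+2%:R) by exact: AA.
by rewrite mulrCA divff ?mulr1// pnatr_eq0.
Qed.

HB.instance Definition _ k :=
  Uniform_isComplete.Build (holder k theta) (@holder_complete k).

End HolderBounds.

(** * Power series in a Banach space *)

Section Geometric.
Context {R : realType}.

Lemma sum_geometric_tail (q : R) N n :
  (\sum_(k < n) (N <= k)%:R * q ^+ k) * (1 - q) = q ^+ N - q ^+ maxn N n.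
Proof.
elim: n => [|n IH]; first by rewrite big_ord0 mul0r maxn0 subrr.
rewrite big_ord_recr/= mulrDl IH; have [Nn|nN] := leqP N n.
  by rewrite (maxn_idPr _) ?leqW// mul1r mulrBr mulr1 exprSr; ring.
by rewrite !mul0r addr0 (maxn_idPl _).
Qed.

(** Up to the factor [r - q], this compares [(k+1) q^k] with the sum of the [r^i q^j] over
    [i + j = k]. It plays the part of Cauchy's estimate: the factor [k + 1] of a differentiation is
    paid for by a smaller radius. *)
Lemma ler_nat_expr (q r : R) k : 0 <= q -> q <= r ->
  k.+1%:R * q ^+ k * (r - q) <= r ^+ k.+1.
Proof.
move=> q0 qr; elim: k => [|k IH]; first by rewrite expr0 expr1; lra.
have -> : k.+2%:R * q ^+ k.+1 * (r - q) =
   q * (k.+1%:R * q ^+ k * (r - q)) + q ^+ k.+1 * (r - q).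
  by rewrite -(natr1 k.+1) exprS; ring.
have -> : r ^+ k.+2 = q * r ^+ k.+1 + r ^+ k.+1 * (r - q) by rewrite (exprS _ k.+1); ring.
by rewrite lerD// ?ler_wpM2l// ler_wpM2r ?subr_ge0// lerXn2r// nnegrE (le_trans q0).
Qed.

Lemma cvg_nat_sqr_expr (q : R) : 0 <= q -> q < 1 ->
  (n.+1%:R ^+ 2 * q ^+ n @[n --> \oo] --> (0 : R)).
Proof.
(* Each factor [n + 1] is absorbed by one enlargement of the base, from [q] to [r] and from [r] to
   [s], which stays below 1. *)
move=> q0 q1; pose r := q + (1 - q) / 3; pose s := q + 2 * (1 - q) / 3.
have qr : q < r by rewrite /r; lra.
have rs : r < s by rewrite /r /s; lra.
have s1 : s < 1 by rewrite /s; lra.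
have r0 : 0 <= r by lra.
have s0 : 0 <= s by lra.
pose C := (r / (r - q)) * (s / (s - r)).
apply: (@squeeze_cvgr _ _ _ _ (fun=> 0) (fun n => C * s ^+ n)).
- apply: nearW => n; rewrite mulr_ge0 ?exprn_ge0//=.
  have H1 : n.+1%:R * q ^+ n <= r / (r - q) * r ^+ n.
    by rewrite mulrAC -exprS ler_pdivlMr ?subr_gt0// ler_nat_expr// ltW.
  have H2 : n.+1%:R * r ^+ n <= s / (s - r) * s ^+ n.
    by rewrite mulrAC -exprS ler_pdivlMr ?subr_gt0// ler_nat_expr// ltW.
  rewrite expr2 -mulrA /C -mulrA.
  apply: (@le_trans _ _ (n.+1%:R * (r / (r - q) * r ^+ n))); first by rewrite ler_wpM2l.
  by rewrite mulrCA ler_wpM2l// divr_ge0// subr_ge0 ltW.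
- exact: cvg_cst.
- rewrite -[0](mulr0 C); apply: cvgM; first exact: cvg_cst.
  by apply: cvg_expr; rewrite ger0_norm.
Qed.

Lemma sum_triangle (V : nmodType) (F : nat -> nat -> V) N :
  \sum_(n < N) \sum_(i < n.+1) F i (n - i)%N =
  \sum_(i < N) \sum_(j < N | (i + j < N)%N) F i j.
Proof.
have E n : (n < N)%N -> \sum_(i < n.+1) F i (n - i)%N =
    \sum_(i < N | (i <= n)%N) F i (n - i)%N.
  by move=> nN; rewrite (big_ord_widen _ (fun i => F i (n - i)%N) nN).
under eq_bigr => n _ do rewrite E//.
rewrite (exchange_big_dep predT)//=; apply: eq_bigr => i _.
rewrite -(big_geq_mkord i N xpredT (fun n => F i (n - i)%N)) -{1}(add0n i) big_addn.
rewrite big_mkord (big_ord_widen N (fun j => F i (j + i - i)%N)) ?leq_subr//.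
by apply: eq_big => [j|j _]; rewrite ?addnK// ltn_subRL.
Qed.

End Geometric.

Section Bilinear.
Context {R : pzRingType} {V W X : lmodType R}.
Variable B : V -> W -> X.
Hypothesis Bl : forall x y z s, B (s *: x + y) z = s *: B x z + B y z.
Hypothesis Br : forall x y z s, B x (s *: y + z) = s *: B x y + B x z.

Lemma bilinear0l y : B 0 y = 0.
Proof. by have := Bl 0 0 y (-1); rewrite scaler0 add0r scaleN1r addNr. Qed.

Lemma bilinear0r x : B x 0 = 0.
Proof. by have := Br x 0 0 (-1); rewrite scaler0 add0r scaleN1r addNr. Qed.

Lemma bilinearDl x y z : B (x + y) z = B x z + B y z.
Proof. by rewrite -[x]scale1r Bl !scale1r. Qed.

Lemma bilinearDr x y z : B x (y + z) = B x y + B x z.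
Proof. by rewrite -[y]scale1r Br !scale1r. Qed.

Lemma bilinearZl s x z : B (s *: x) z = s *: B x z.
Proof. by rewrite -[s *: x]addr0 Bl bilinear0l addr0. Qed.

Lemma bilinearZr s x z : B x (s *: z) = s *: B x z.
Proof. by rewrite -[s *: z]addr0 Br bilinear0r addr0. Qed.

Lemma bilinear_suml n (F : nat -> V) z :
  B (\sum_(i < n) F i) z = \sum_(i < n) B (F i) z.
Proof.
by elim: n => [|n IH]; rewrite ?big_ord0 ?bilinear0l// !big_ord_recr/= bilinearDl IH.
Qed.

Lemma bilinear_sumr n (F : nat -> W) z :
  B z (\sum_(i < n) F i) = \sum_(i < n) B z (F i).
Proof.
by elim: n => [|n IH]; rewrite ?big_ord0 ?bilinear0r// !big_ord_recr/= bilinearDr IH.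
Qed.

End Bilinear.

Section PowerSeries.
Context {R : realType} {V : completeNormedModType R}.
Implicit Types (c d : nat -> V) (t r T A q : R).

Definition psum c t : V := limn (series (fun k => t ^+ k *: c k)).

(** The only information kept about a series. It gives convergence for [|t| < T] and, unlike
    convergence, estimates that are uniform over all series with the same [A]. *)
Definition coef_bound T A c := forall k, `|c k| * T ^+ k <= A.

Lemma coef_bound_term T A c t q k : coef_bound T A c ->
  0 <= q -> 0 <= T -> `|t| <= q * T -> `|t ^+ k *: c k| <= A * q ^+ k.
Proof.
move=> cA q0 T0 tq; rewrite normrZ normrX.
apply: (@le_trans _ _ ((q * T) ^+ k * `|c k|)).
  by rewrite ler_wpM2r// lerXn2r// nnegrE mulr_ge0.
by rewrite exprMn -mulrA mulrC ler_wpM2r ?exprn_ge0// mulrC cA.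
Qed.

Lemma psum_is_cvg T A c t : 0 < T -> coef_bound T A c -> `|t| < T ->
  series (fun k => t ^+ k *: c k) @ \oo --> psum c t.
Proof.
move=> T0 cA tT; pose q := `|t| / T.
have q0 : 0 <= q by rewrite divr_ge0// ltW.
have q1 : q < 1 by rewrite ltr_pdivrMr// mul1r.
have tq : `|t| <= q * T by rewrite /q divfK// gt_eqF.
suff : cvgn (series (fun k => t ^+ k *: c k)) by [].
apply: normed_cvg; apply: (@series_le_cvg _ _ (geometric A q)).
- by move=> n /=.
- by move=> n; apply: mulr_ge0; rewrite ?exprn_ge0// (le_trans _ (cA 0%N))// mulr_ge0// exprn_ge0// ltW.
- by move=> n; exact: (coef_bound_term _ cA q0 (ltW T0) tq).
- by apply: is_cvg_geometric_series; rewrite ger0_norm.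
Qed.

Lemma ler_cvg_norm (W : normedModType R) (u : nat -> W) (l : W) (M : R) :
  u @ \oo --> l -> (forall n, `|u n| <= M) -> `|l| <= M.
Proof.
move=> ul uM; have H : (fun n => `|u n|) @ \oo --> `|l| by apply: cvg_norm.
rewrite -(cvg_lim (@Rhausdorff R) H); apply: limr_le; last exact: nearW.
by apply/cvg_ex; exists `|l|.
Qed.

Lemma cvg_dist0P (W : normedModType R) (u : nat -> W) (l : W) :
  (fun n => `|l - u n|) @ \oo --> (0 : R) <-> u @ \oo --> l.
Proof.
split=> [/cvgrPdist_le H|/cvgrPdist_le H]; apply/cvgrPdist_le => e /H;
  by apply: filterS => n; rewrite sub0r normrN normr_id.
Qed.

(** Comparison with the geometric series from [N] on. The gain [q ^+ N] will give the convergence of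
    the expansions in the data. *)
Lemma psum_bound T A c t q N : 0 < T -> coef_bound T A c ->
  0 <= q -> q < 1 -> `|t| <= q * T -> (forall k, (k < N)%N -> c k = 0) ->
  `|psum c t| <= A * q ^+ N / (1 - q).
Proof.
move=> T0 cA q0 q1 tq cN.
have tT : `|t| < T by rewrite (le_lt_trans tq)// gtr_pMl.
have A0 : 0 <= A by rewrite (le_trans _ (cA 0%N))// mulr_ge0// exprn_ge0// ltW.
have H := psum_is_cvg T0 cA tT.
apply: (ler_cvg_norm H) => n; rewrite /series/= big_mkord.
apply: (le_trans (ler_norm_sum _ _ _)).
apply: (@le_trans _ _ (\sum_(k < n) A * ((N <= k)%:R * q ^+ k))).
  apply: ler_sum => k _; have [Nk|kN] := leqP N k.
    by rewrite mul1r; exact: (coef_bound_term _ cA q0 (ltW T0) tq).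
  by rewrite cN// scaler0 normr0 mul0r mulr0.
rewrite -mulr_sumr ler_pdivlMr ?subr_gt0// -mulrA ler_wpM2l//.
by rewrite sum_geometric_tail gerBl exprn_ge0.
Qed.

Lemma psum_lin T A B (a : R) c d t : 0 < T -> coef_bound T A c -> coef_bound T B d ->
  `|t| < T -> psum (fun k => a *: c k + d k) t = a *: psum c t + psum d t.
Proof.
move=> T0 cA dB tT; apply: cvg_lim; first exact: norm_hausdorff.
have -> : series (fun k => t ^+ k *: (a *: c k + d k)) =
   (fun n => a *: series (fun k => t ^+ k *: c k) n + series (fun k => t ^+ k *: d k) n).
  apply/funext => n; rewrite /series/= scaler_sumr -big_split/=.
  by apply: eq_bigr => k _; rewrite scalerDr !scalerA mulrC.
apply: cvgD; last exact: psum_is_cvg dB tT.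
by apply: cvgZ; [exact: cvg_cst|exact: psum_is_cvg cA tT].
Qed.

Lemma psum0 c : psum c 0 = c 0%N.
Proof.
apply: cvg_lim; first exact: norm_hausdorff.
rewrite -cvg_shiftS/=; apply: cvg_near_cst; apply: nearW => n.
rewrite /series/= big_nat_recl// expr0 scale1r big1 ?addr0// => i _.
by rewrite exprS mul0r scale0r.
Qed.

Definition dcoef c k : V := k.+1%:R *: c k.+1.

Lemma coef_bound_dcoef T A r c : 0 < r -> r < T -> coef_bound T A c ->
  coef_bound r (A / (T - r)) (dcoef c).
Proof.
move=> r0 rT cA k; rewrite /dcoef normrZ ger0_norm//.
rewrite ler_pdivlMr ?subr_gt0//.
have -> : k.+1%:R * `|c k.+1| * r ^+ k * (T - r) =
  `|c k.+1| * (k.+1%:R * r ^+ k * (T - r)) by ring.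
by apply: le_trans (cA k.+1); rewrite ler_wpM2l// ler_nat_expr// ltW.
Qed.

(** The factor [(k+2)(k+1) rho^k] is the one that two formal differentiations produce at [rho], so
    that the remainders of all the monomials add up to a convergent series. *)
Lemma monomial_remainder (t h rho : R) k : `|t| <= rho -> `|t + h| <= rho ->
  `|(t + h) ^+ k.+2 - t ^+ k.+2 - h * (k.+2%:R * t ^+ k.+1)| <=
  h ^+ 2 * (k.+2%:R * k.+1%:R * rho ^+ k).
Proof.
move=> tr thr; have rho0 : 0 <= rho by apply: le_trans tr.
elim: k => [|k IH].
  have -> : (t + h) ^+ 2 - t ^+ 2 - h * (2 * t ^+ 1) = h ^+ 2 by ring.
  rewrite ger0_norm ?sqr_ge0// expr0 !mulr1 ler_peMr ?sqr_ge0// ler1n//.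
set e := (X in `|X| <= _) in IH.
have -> : (t + h) ^+ k.+3 - t ^+ k.+3 - h * (k.+3%:R * t ^+ k.+2) =
    (t + h) * e + h ^+ 2 * (k.+2%:R * t ^+ k.+1).
  by rewrite /e -(natr1 k.+2) !(exprS _ k.+2) !(exprS _ k.+1); ring.
apply: (le_trans (ler_normD _ _)); rewrite !normrM.
apply: (@le_trans _ _ (rho * (h ^+ 2 * (k.+2%:R * k.+1%:R * rho ^+ k))
   + h ^+ 2 * (k.+2%:R * rho ^+ k.+1))).
  apply: lerD; first exact: ler_pM.
  rewrite -[`|h| * `|h|]expr2 real_normK ?num_real// ler_wpM2l ?sqr_ge0//.
  rewrite ger0_norm// ler_wpM2l//.
  by rewrite normrX lerXn2r.
have -> : rho * (h ^+ 2 * (k.+2%:R * k.+1%:R * rho ^+ k)) + h ^+ 2 * (k.+2%:R * rho ^+ k.+1)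
  = h ^+ 2 * (k.+2%:R * (k.+1%:R + 1) * rho ^+ k.+1) by rewrite (exprS rho); ring.
rewrite natr1 ler_wpM2l ?sqr_ge0// ler_wpM2r ?exprn_ge0// ler_wpM2r//.
by rewrite ler_nat.
Qed.

(** The monomials of degree 0 and 1 have no second order remainder, whence the shift by two on the
    right. *)
Lemma taylor_partial_sum c (t h : R) n :
  \sum_(k < n.+2) (t + h) ^+ k *: c k - \sum_(k < n.+2) t ^+ k *: c k -
  h *: (\sum_(k < n.+1) t ^+ k *: dcoef c k) =
  \sum_(k < n) ((t + h) ^+ k.+2 - t ^+ k.+2 - h * (k.+2%:R * t ^+ k.+1)) *: c k.+2.
Proof.
elim: n => [|n IH].
  rewrite big_ord0 !big_ord_recr !big_ord0/= !add0r /dcoef !expr0 !expr1 !scale1r.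
  rewrite opprD addrACA subrr add0r -!scalerBl.
  by rewrite (_ : _ - _ - _ = 0) ?scale0r//; ring.
have E (X Y Z a b d : V) : X + a - (Y + b) - (Z + d) = X - Y - Z + (a - b - d).
  by rewrite !opprD (addrACA X a) (addrACA (X - Y)).
rewrite [\sum_(k < n.+3) (t + h) ^+ k *: c k]big_ord_recr.
rewrite [\sum_(k < n.+3) t ^+ k *: c k]big_ord_recr.
rewrite [\sum_(k < n.+2) t ^+ k *: dcoef c k]big_ord_recr.
rewrite [in RHS]big_ord_recr/= -IH scalerDr E; congr (_ + _).
by rewrite /dcoef !scalerA -!scalerBl; congr (_ *: _); ring.
Qed.

Lemma is_derive_psum T A c t : 0 < T -> coef_bound T A c -> `|t| < T ->
  is_derive t 1 (psum c) (psum (dcoef c) t).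
Proof.
move=> T0 cA tT.
(* The radii satisfy [|t| < rho < r1 < r2 < T]. Two differentiations take [T] to [r2] and [r2] to
   [r1]; the gap below [r1] gives a geometric ratio [q < 1], and the gap above [|t|] leaves room for
   [t + h]. *)
pose rho := `|t| + (T - `|t|) / 4; pose r1 := `|t| + (T - `|t|) / 3.
pose r2 := `|t| + (T - `|t|) / 2.
have t0 : 0 <= `|t| by [].
have trho : `|t| < rho by rewrite /rho; lra.
have rhor : rho < r1 by rewrite /rho /r1; lra.
have r12 : r1 < r2 by rewrite /r1 /r2; lra.
have r2T : r2 < T by rewrite /r2; lra.
have r20 : 0 < r2 by lra.
have r10 : 0 < r1 by lra.
have rho0 : 0 < rho by lra.
have c1 := coef_bound_dcoef r20 r2T cA.
have c2 := coef_bound_dcoef r10 r12 c1.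
set A1 := A / (T - r2) in c1; set A2 := A1 / (r2 - r1) in c2.
have A20 : 0 <= A2 by rewrite (le_trans _ (c2 0%N))// mulr_ge0// exprn_ge0// ltW.
pose q := rho / r1.
have q0 : 0 <= q by rewrite divr_ge0// ltW.
have q1 : q < 1 by rewrite ltr_pdivrMr// mul1r.
have rq : rho = q * r1 by rewrite /q divfK// gt_eqF.
pose K := A2 / (1 - q).
have K0 : 0 <= K by rewrite divr_ge0// subr_ge0 ltW.
have key h : `|t + h| <= rho ->
    `|psum c (t + h) - psum c t - h *: psum (dcoef c) t| <= h ^+ 2 * K.
  move=> thr.
  have thT : `|t + h| < T by lra.
  have tr2 : `|t| < r2 by lra.
  have S1 := psum_is_cvg T0 cA thT; have S2 := psum_is_cvg T0 cA tT.
  have S3 := psum_is_cvg r20 c1 tr2.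
  have S : (fun n => series (fun k => (t + h) ^+ k *: c k) n.+2
      - series (fun k => t ^+ k *: c k) n.+2
      - h *: series (fun k => t ^+ k *: dcoef c k) n.+1) @ \oo -->
      psum c (t + h) - psum c t - h *: psum (dcoef c) t.
    apply: cvgB; first by apply: cvgB; rewrite !(cvg_shiftS (fun n => series _ n.+1)) cvg_shiftS.
    by apply: cvgZ; [exact: cvg_cst|rewrite (cvg_shiftS (series _))].
  apply: (ler_cvg_norm S) => n.
  have -> : series (fun k => (t + h) ^+ k *: c k) n.+2
      - series (fun k => t ^+ k *: c k) n.+2
      - h *: series (fun k => t ^+ k *: dcoef c k) n.+1 =
      \sum_(k < n) ((t + h) ^+ k.+2 - t ^+ k.+2 - h * (k.+2%:R * t ^+ k.+1)) *: c k.+2.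
    by rewrite /series/= !big_mkord taylor_partial_sum.
  apply: (le_trans (ler_norm_sum _ _ _)).
  apply: (@le_trans _ _ (\sum_(k < n) h ^+ 2 * (A2 * ((0 <= k)%N%:R * q ^+ k)))).
    apply: ler_sum => k _; rewrite normrZ.
    apply: (@le_trans _ _ (h ^+ 2 * (k.+2%:R * k.+1%:R * rho ^+ k) * `|c k.+2|)).
      by rewrite ler_wpM2r// monomial_remainder// ltW.
    rewrite -mulrA ler_wpM2l ?sqr_ge0// mul1r.
    have := coef_bound_term k c2 q0 (ltW r10) (_ : `|rho| <= q * r1).
    rewrite -rq ger0_norm ?(ltW rho0)// lexx => /(_ isT); apply: le_trans.
    rewrite /dcoef !normrZ normrX (ger0_norm (ltW rho0)) !ger0_norm//.
    by rewrite le_eqVlt; apply/orP; left; apply/eqP; ring.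
  have -> : \sum_(k < n) h ^+ 2 * (A2 * ((0 <= k)%N%:R * q ^+ k)) =
      h ^+ 2 * (A2 * \sum_(k < n) (0 <= k)%N%:R * q ^+ k) by rewrite !mulr_sumr.
  rewrite ler_wpM2l ?sqr_ge0// /K ler_wpM2l//.
  rewrite -[_^-1]mul1r ler_pdivlMr ?subr_gt0// sum_geometric_tail expr0.
  by rewrite gerBl exprn_ge0.
apply: cvg_is_derive1; apply/cvgrPdist_le => e e0.
have dn0 : 0 < (rho - `|t|) by lra.
have dK : 0 < e / (K + 1) by rewrite divr_gt0// ltr_wpDl.
near=> h.
have h0 : h != 0 by near: h; exact: nbhs_dnbhs_neq.
have h1 : `|h| <= rho - `|t| by near: h; exact: dnbhs0_le.
have h2 : `|h| <= e / (K + 1) by near: h; exact: dnbhs0_le.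
have thr : `|t + h| <= rho by apply: (le_trans (ler_normD _ _)); lra.
have hh : 0 < `|h| by rewrite normr_gt0.
rewrite -(ler_pM2l hh) -normrZ scalerBr scalerA divff// scale1r -normrN opprB.
rewrite [h + t]addrC (le_trans (key h thr))//.
rewrite -(ger0_norm (sqr_ge0 h)) normrX expr2 -mulrA ler_pM2l//.
by move: h2; rewrite ler_pdivlMr ?ltr_wpDl//; nra.
Unshelve. all: by end_near. Qed.

(** Each differentiation uses up half of the remaining gap between [r] and [T]. The constant depends
    on [m], [r] and [T] but not on the series, so the estimates are uniform in the data. *)
Lemma coef_bound_iter_dcoef T r m : 0 < r -> r < T -> exists2 C, 0 <= C &
  forall A c, coef_bound T A c -> coef_bound r (C * A) (iter m dcoef c).
Proof.
elim: m r => [|m IH] r r0 rT.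
  exists 1 => // A c cA k; rewrite mul1r; apply: le_trans (cA k).
  by rewrite ler_wpM2l// lerXn2r// ?nnegrE ltW// (lt_trans r0).
pose s := (r + T) / 2.
have rs : r < s by rewrite /s; lra.
have sT : s < T by rewrite /s; lra.
have [C C0 H] := IH s (lt_trans r0 rs) sT.
exists (C / (s - r)); first by rewrite divr_ge0// subr_ge0 ltW.
move=> A c cA; rewrite mulrAC iterS; apply: coef_bound_dcoef => //; exact: H.
Qed.

(** Agreement of [f] with the sum for [|s| < T] suffices, derivatives being local. This covers
    finite sums of series, which are identified with a single series only on that interval. *)
Lemma derive1n_psum T A c (f : R -> V) m t : 0 < T -> coef_bound T A c ->
  (forall s, `|s| < T -> f s = psum c s) -> `|t| < T ->
  derivable (f^`(m)) t 1 /\ f^`(m) t = psum (iter m dcoef c) t.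
Proof.
move=> T0 cA fc.
suff H s : `|s| < T -> f^`(m) s = psum (iter m dcoef c) s.
  move=> tT; split; last exact: H.
  pose r := (`|t| + T) / 2; have t0 : 0 <= `|t| by [].
  have tr : `|t| < r by rewrite /r; lra.
  have rT : r < T by rewrite /r; lra.
  have r0 : 0 < r by lra.
  have [C C0 bC] := coef_bound_iter_dcoef m r0 rT.
  have [+ _] := is_derive_psum r0 (bC _ _ cA) tr.
  apply: near_eq_derivable; near=> s; apply/esym/H.
  near: s; have /cvgr_norm_lt := @cvg_id _ (nbhs t); exact.
elim: m s => [|m IH] s sT; first exact: fc.
pose r := (`|s| + T) / 2; have s0 : 0 <= `|s| by [].
have sr : `|s| < r by rewrite /r; lra.
have rT : r < T by rewrite /r; lra.
have r0 : 0 < r by lra.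
have [C C0 bC] := coef_bound_iter_dcoef m r0 rT.
have [_ <-] := is_derive_psum r0 (bC _ _ cA) sr.
rewrite derive1nS derive1E; apply: near_eq_derive; near=> z; apply: IH.
near: z; have /cvgr_norm_lt := @cvg_id _ (nbhs s); exact.
Unshelve. all: by end_near. Qed.

Lemma iter_dcoef0 c N m : (forall k, (k < N + m)%N -> c k = 0) ->
  forall k, (k < N)%N -> iter m dcoef c k = 0.
Proof.
elim: m N => [|m IH] N c0 k kN; first by apply: c0; rewrite addn0.
by rewrite iterS /dcoef (IH N.+1) ?scaler0// => j; rewrite addSnnS; exact: c0.
Qed.

Lemma psum_iter_dcoef_bound T S q m : 0 < T -> 0 < q -> q < 1 -> S < q * T ->
  exists2 C, 0 <= C & forall A c N t, coef_bound T A c ->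
  (forall k, (k < N)%N -> iter m dcoef c k = 0) ->
  `|t| <= S -> `|psum (iter m dcoef c) t| <= C * A * q ^+ N.
Proof.
(* Negative [S] are allowed by the notions of convergence and analyticity; the interval is then
   empty. *)
move=> T0 q0 q1 SqT; have [S0|S0] := ltP S 0.
  exists 0 => // A c N t _ _ tS.
  by have := le_lt_trans tS S0; rewrite normr_lt0.
pose r := (S / q + T) / 2.
have SqT' : S / q < T by rewrite ltr_pdivrMr// mulrC.
have Sq0 : 0 <= S / q by rewrite divr_ge0// ltW.
have Sr : S / q < r by rewrite /r; lra.
have rT : r < T by rewrite /r; lra.
have r0 : 0 < r by lra.
have [C C0 bC] := coef_bound_iter_dcoef m r0 rT.
exists (C / (1 - q)); first by rewrite divr_ge0// subr_ge0 ltW.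
move=> A c N t cA c0 tS.
have tqr : `|t| <= q * r.
  by apply: (le_trans tS); rewrite mulrC -ler_pdivrMr// ltW.
have -> : C / (1 - q) * A * q ^+ N = C * A * q ^+ N / (1 - q) by ring.
exact: (psum_bound r0 (bC _ _ cA) (ltW q0) q1 tqr).
Qed.

Lemma iter_dcoef_lin m (s : R) c d k :
  iter m dcoef (fun k => s *: c k + d k) k = s *: iter m dcoef c k + iter m dcoef d k.
Proof.
elim: m k => [//|m IH] k.
by rewrite !iterS /dcoef IH scalerDr !scalerA (mulrC s).
Qed.

Lemma psum_iter_dcoef_lin T A A' (s : R) c d m t : 0 < T -> coef_bound T A c ->
  coef_bound T A' d -> `|t| < T ->
  psum (iter m dcoef (fun k => s *: c k + d k)) t =
  s *: psum (iter m dcoef c) t + psum (iter m dcoef d) t.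
Proof.
move=> T0 cA dA' tT; pose r := (`|t| + T) / 2; have t0 : 0 <= `|t| by [].
have tr : `|t| < r by rewrite /r; lra.
have rT : r < T by rewrite /r; lra.
have r0 : 0 < r by lra.
have [C C0 bC] := coef_bound_iter_dcoef m r0 rT.
rewrite -(psum_lin s r0 (bC _ _ cA) (bC _ _ dA') tr).
by congr psum; apply/funext => k; rewrite iter_dcoef_lin.
Qed.

(** Cauchy product. [B] of the partial sums of length [n] exceeds the partial sum of the product
    series by the terms with [i, j < n <= i + j]. There are at most [n^2] of them, each bounded by
    [be A A' q^n]. *)
Lemma psum_bilinear (B : V -> V -> V) (be : R) T A A' a b t : 0 < T ->
  (forall x y z s, B (s *: x + y) z = s *: B x z + B y z) ->
  (forall x y z s, B x (s *: y + z) = s *: B x y + B x z) ->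
  0 <= be -> (forall x y, `|B x y| <= be * (`|x| * `|y|)) ->
  coef_bound T A a -> coef_bound T A' b -> `|t| < T ->
  series (fun n => t ^+ n *: \sum_(i < n.+1) B (a i) (b (n - i)%N)) @ \oo
    --> B (psum a t) (psum b t).
Proof.
move=> T0 Bl Br be0 Bbe aA bA' tT.
pose q := `|t| / T.
have q0 : 0 <= q by rewrite divr_ge0// ltW.
have q1 : q < 1 by rewrite ltr_pdivrMr// mul1r.
have tq : `|t| <= q * T by rewrite /q divfK// gt_eqF.
have A0 : 0 <= A by rewrite (le_trans _ (aA 0%N))// mulr_ge0// exprn_ge0// ltW.
have A'0 : 0 <= A' by rewrite (le_trans _ (bA' 0%N))// mulr_ge0// exprn_ge0// ltW.
pose Sa := series (fun k => t ^+ k *: a k); pose Sb := series (fun k => t ^+ k *: b k).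
have Sal : Sa @ \oo --> psum a t by exact: psum_is_cvg aA tT.
have Sbl : Sb @ \oo --> psum b t by exact: psum_is_cvg bA' tT.
have SB : (fun n => B (Sa n) (Sb n)) @ \oo --> B (psum a t) (psum b t).
  apply/cvg_dist0P.
  pose w n := be * (`|psum a t - Sa n| * `|Sb n| + `|psum a t| * `|psum b t - Sb n|).
  apply: (@squeeze_cvgr _ _ _ _ (fun=> 0) w).
  - apply: nearW => n; rewrite normr_ge0/=.
    have -> : B (psum a t) (psum b t) - B (Sa n) (Sb n) =
       B (psum a t - Sa n) (Sb n) + B (psum a t) (psum b t - Sb n).
      rewrite (bilinearDl Bl) (bilinearDr Br) -[- Sa n]scaleN1r -[- Sb n]scaleN1r.
      rewrite (bilinearZl Bl) (bilinearZr Br) !scaleN1r.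
      by rewrite [RHS]addrC addrA subrK.
    by apply: (le_trans (ler_normD _ _)); rewrite /w mulrDr lerD.
  - exact: cvg_cst.
  - have -> : 0 = be * (`|psum a t - psum a t| * `|psum b t| + `|psum a t| * `|psum b t - psum b t|).
      by rewrite !subrr normr0 mulr0 mul0r addr0 mulr0.
    apply: cvgM; first exact: cvg_cst.
    by apply: cvgD; apply: cvgM; try exact: cvg_cst; apply: cvg_norm => //;
      apply: cvgB => //; exact: cvg_cst.
pose D n : V := B (Sa n) (Sb n) -
   series (fun n => t ^+ n *: \sum_(i < n.+1) B (a i) (b (n - i)%N)) n.
have Dl : D @ \oo --> (0 : V).
  apply/cvg_dist0P; under eq_fun do rewrite sub0r normrN.
  apply: (@squeeze_cvgr _ _ _ _ (fun=> 0) (fun n => be * A * A' * (n.+1%:R ^+ 2 * q ^+ n))).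
  - apply: nearW => n; rewrite normr_ge0/=.
    have -> : D n = \sum_(i < n) \sum_(j < n | ~~ (i + j < n)%N)
        t ^+ (i + j) *: B (a i) (b j).
      rewrite /D.
      have -> : Sa n = \sum_(k < n) t ^+ k *: a k by rewrite /Sa /series/= big_mkord.
      have -> : Sb n = \sum_(k < n) t ^+ k *: b k by rewrite /Sb /series/= big_mkord.
      rewrite (bilinear_suml Bl n (fun k => t ^+ k *: a k)) /series/= big_mkord.
      under eq_bigr => i _ do rewrite (bilinear_sumr Br n (fun k => t ^+ k *: b k)).
      under [X in _ - X]eq_bigr => i _ do rewrite scaler_sumr.
      have -> : \sum_(i < n) \sum_(i0 < i.+1) t ^+ i *: B (a i0) (b (i - i0)%N) =
         \sum_(i < n) \sum_(i0 < i.+1) t ^+ (i0 + (i - i0)) *: B (a i0) (b (i - i0)%N).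
        apply: eq_bigr => i _; apply: eq_bigr => j _.
        by rewrite subnKC// -ltnS.
      rewrite (sum_triangle (fun i j => t ^+ (i + j) *: B (a i) (b j))) -sumrB.
      apply: eq_bigr => i _.
      rewrite (bigID (fun j : 'I_n => (i + j < n)%N))/= addrAC.
      rewrite [X in X + _](_ : _ = 0) ?add0r.
        by apply: eq_bigr => j _; rewrite (bilinearZl Bl) (bilinearZr Br) scalerA exprD.
      apply/eqP; rewrite subr_eq0; apply/eqP.
      by apply: eq_bigr => j _; rewrite (bilinearZl Bl) (bilinearZr Br) scalerA exprD.
    apply: (@le_trans _ _ (\sum_(i < n) \sum_(j < n) be * A * A' * q ^+ n)).
      apply: (le_trans (ler_norm_sum _ _ _)); apply: ler_sum => i _.
      apply: (le_trans (ler_norm_sum _ _ _)).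
      rewrite [leRHS](bigID (fun j : 'I_n => (i + j < n)%N))/=.
      rewrite -[leLHS]add0r; apply: lerD.
        by apply: sumr_ge0 => j _; rewrite !mulr_ge0// exprn_ge0.
      apply: ler_sum => j; rewrite -leqNgt => nij.
      rewrite exprD -scalerA -(bilinearZr Br) -(bilinearZl Bl).
      apply: (le_trans (Bbe _ _)); rewrite -!mulrA ler_wpM2l//.
      apply: (@le_trans _ _ ((A * q ^+ i) * (A' * q ^+ j))).
        by apply: ler_pM => //; [exact: (coef_bound_term _ aA q0 (ltW T0) tq)|
          exact: (coef_bound_term _ bA' q0 (ltW T0) tq)].
      rewrite mulrACA -exprD mulrA ler_wpM2l ?mulr_ge0//.
      by rewrite ler_wiXn2l// ltW.
    have -> : \sum_(i < n) \sum_(j < n) be * A * A' * q ^+ n =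
        be * A * A' * ((n * n)%:R * q ^+ n).
      by rewrite !sumr_const card_ord -mulrnA -mulr_natr; ring.
    rewrite ler_wpM2l ?mulr_ge0// ler_wpM2r ?exprn_ge0//.
    by rewrite -natrX ler_nat -mulnn leq_mul.
  - exact: cvg_cst.
  - rewrite -[0](mulr0 (be * A * A')); apply: cvgM; first exact: cvg_cst.
    exact: cvg_nat_sqr_expr.
have -> : series (fun n => t ^+ n *: \sum_(i < n.+1) B (a i) (b (n - i)%N)) =
   (fun n => B (Sa n) (Sb n) - D n) by apply/funext => n; rewrite /D subKr.
by rewrite -[X in _ --> X]subr0; exact: cvgB.
Qed.

End PowerSeries.

(** * Quadratic differential equations *)

Section StrongRecursion.
Context {X : Type}.
Variables (x0 : X) (step : nat -> (nat -> X) -> X).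

(** The coefficient of index [n + 1] depends on all the previous ones, so the recursion carries a
    table of the values up to [n]. The hypothesis [step_ext] below says that [step n] reads nothing
    beyond it. *)
Fixpoint srec_table n : nat -> X :=
  if n is n'.+1 then
    fun i => if (i <= n')%N then srec_table n' i else step n' (srec_table n')
  else fun=> x0.

Definition srec n := srec_table n n.

Hypothesis step_ext : forall n f g,
  (forall i, (i <= n)%N -> f i = g i) -> step n f = step n g.

Lemma srec_tableE n i : (i <= n)%N -> srec_table n i = srec i.
Proof.
elim: n => [|n IH]; first by rewrite leqn0 => /eqP ->.
rewrite leq_eqVlt => /predU1P[->//|]; rewrite ltnS => jn.
by rewrite /= jn IH.
Qed.

Lemma srecS n : srec n.+1 = step n srec.
Proof. by rewrite /srec/= ltnn; apply: step_ext => i; exact: srec_tableE. Qed.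

End StrongRecursion.

Section Quadratic.
Context {R : realType} {V : completeNormedModType R}.
Variables (A : V -> V) (B : V -> V -> V) (al be : R).
Hypothesis Al : forall x y s, A (s *: x + y) = s *: A x + A y.
Hypothesis Bl : forall x y z s, B (s *: x + y) z = s *: B x z + B y z.
Hypothesis Br : forall x y z s, B x (s *: y + z) = s *: B x y + B x z.
Hypothesis al0 : 0 <= al.
Hypothesis be0 : 0 <= be.
Hypothesis Aal : forall x, `|A x| <= al * `|x|.
Hypothesis Bbe : forall x y, `|B x y| <= be * (`|x| * `|y|).
Implicit Types (a v x y z : V) (s : seq V) (n m N : nat).

Lemma linear_map0 : A 0 = 0.
Proof. by have := Al 0 0 (-1); rewrite scaler0 add0r scaleN1r addNr. Qed.

Lemma linear_mapD x y : A (x + y) = A x + A y.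
Proof. by rewrite -[x]scale1r Al !scale1r. Qed.

Lemma linear_mapZ c x : A (c *: x) = c *: A x.
Proof. by rewrite -[c *: x]addr0 Al linear_map0 addr0. Qed.

Lemma linear_map_sum n (F : nat -> V) : A (\sum_(i < n) F i) = \sum_(i < n) A (F i).
Proof. by elim: n => [|n IH]; rewrite ?big_ord0 ?linear_map0// !big_ord_recr/= linear_mapD IH. Qed.

(* [taylor a n [:: h_1; ...; h_m]] is the m-linear part, at [(h_1, ..., h_m)], of
   the expansion at [a] of the coefficient of [t^n] in the solution. *)
Definition taylor0 a s : V :=
  match s with [::] => a | [:: x] => x | _ => 0 end.

(** Comparison of the coefficients of [t^n] in [u' = - (A u + B(u, u))]. The arguments are split
    only into a prefix and a suffix, so the multilinear maps need not be symmetric; on constant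
    lists each splitting of the degree occurs exactly once, as the expansion requires. *)
Definition taylor_step n (f : nat -> seq V -> V) s : V :=
  - n.+1%:R^-1 *: (A (f n s) + \sum_(i < n.+1) \sum_(l < (size s).+1)
     B (f i (take l s)) (f (n - i)%N (drop l s))).

Definition taylor a : nat -> seq V -> V := srec (taylor0 a) taylor_step.

Lemma taylorS a n s : taylor a n.+1 s =
  - n.+1%:R^-1 *: (A (taylor a n s) + \sum_(i < n.+1) \sum_(l < (size s).+1)
     B (taylor a i (take l s)) (taylor a (n - i)%N (drop l s))).
Proof.
rewrite /taylor srecS// => {}n f g fg; apply/funext => {}s.
rewrite /taylor_step fg//; congr (_ *: (_ + _)).
apply: eq_bigr => i _; apply: eq_bigr => l _.
by rewrite !fg ?leq_subr// -ltnS.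
Qed.

(* The coefficient of ['X^m] in [majorant a n] bounds the norm of the m-linear map
   [taylor a n]; evaluation at 1 turns these bounds into a scalar recursion. *)
Definition majorant_step n (f : nat -> {poly R}) : {poly R} :=
  n.+1%:R^-1 *: (al *: f n + be *: \sum_(i < n.+1) f i * f (n - i)%N).

Definition majorant a : nat -> {poly R} := srec (`|a|%:P + 'X) majorant_step.

Lemma majorantS a n : majorant a n.+1 =
  n.+1%:R^-1 *: (al *: majorant a n
    + be *: \sum_(i < n.+1) majorant a i * majorant a (n - i)%N).
Proof.
rewrite /majorant srecS// => {}n f g fg.
rewrite /majorant_step fg//; congr (_ *: (_ + _ *: _)).
by apply: eq_bigr => i _; rewrite !fg ?leq_subr// -ltnS.
Qed.

Lemma coef_majorantS a n m : (majorant a n.+1)`_m =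
  n.+1%:R^-1 * (al * (majorant a n)`_m + be * \sum_(i < n.+1) \sum_(l < m.+1)
    (majorant a i)`_l * (majorant a (n - i)%N)`_(m - l)).
Proof.
rewrite majorantS coefZ coefD !coefZ coef_sum; congr (_ * (_ + _ * _)).
by apply: eq_bigr => i _; rewrite coefM.
Qed.

Lemma majorant_ge0 a n m : 0 <= (majorant a n)`_m.
Proof.
elim/ltn_ind: n m => -[|n] IH m.
  rewrite /majorant /srec/= coefD coefC coefX addr_ge0//; first by case: ifP.
rewrite coef_majorantS mulr_ge0 ?invr_ge0// addr_ge0// mulr_ge0 ?IH//.
apply: sumr_ge0 => i _; apply: sumr_ge0 => l _.
by rewrite mulr_ge0// IH// ltnS leq_subr.
Qed.

(** The convolution has [n + 1] terms, each at most [D^2 M^n], and the denominator [n + 1] cancels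
    their number. The linear term occurs once where [n + 1] copies of it are allowed. *)
Lemma majorant1_bound a n :
  0 <= (majorant a n).[1] <= (`|a| + 1) * (al + be * (`|a| + 1)) ^+ n.
Proof.
set D := `|a| + 1; set M := al + be * D.
have D0 : 0 <= D by rewrite addr_ge0.
have M0 : 0 <= M by rewrite addr_ge0// mulr_ge0.
elim/ltn_ind: n => -[|n] IH.
  by rewrite /majorant /srec/= hornerD hornerC hornerX expr0 mulr1 lexx andbT.
rewrite majorantS !hornerE horner_sum.
have [/andP[n0 nM]] := IH n (ltnSn n).
have H (i : 'I_n.+1) : 0 <= (majorant a i * majorant a (n - i)%N).[1] <= D ^+ 2 * M ^+ n.
  rewrite hornerM; have /andP[i0 iM] := IH i (ltn_ord i).
  have /andP[j0 jM] := IH (n - i)%N (leq_subr _ _).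
  rewrite mulr_ge0//= (le_trans (ler_pM i0 j0 iM jM))// mulrACA -expr2 -exprD.
  by rewrite subnKC// -ltnS.
have S0 : 0 <= \sum_(i < n.+1) (majorant a i * majorant a (n - i)%N).[1].
  by apply: sumr_ge0 => i _; case/andP: (H i).
apply/andP; split.
  by rewrite mulr_ge0 ?invr_ge0// addr_ge0// mulr_ge0.
rewrite ler_pdivrMl//.
have -> : n.+1%:R * (D * M ^+ n.+1) =
  n%:R * (al * (D * M ^+ n)) + al * (D * M ^+ n) + be * (n.+1%:R * (D ^+ 2 * M ^+ n)).
  by rewrite exprS (_ : M * M ^+ n = (al + be * D) * M ^+ n)// -natr1; ring.
apply: lerD.
  rewrite -[leLHS]add0r; apply: lerD; first by rewrite !mulr_ge0// exprn_ge0.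
  by rewrite ler_wpM2l.
rewrite ler_wpM2l// mulr_natl -[in leRHS](card_ord n.+1) -sumr_const.
by apply: ler_sum => i _; case/andP: (H i).
Qed.

Lemma majorant_sum a n N :
  \sum_(m < N) (majorant a n)`_m <= (`|a| + 1) * (al + be * (`|a| + 1)) ^+ n.
Proof.
have /andP[_] := majorant1_bound a n; apply: le_trans.
set p := majorant a n.
rewrite (@horner_coef_wide _ (maxn N (size p)) p) ?leq_maxr//.
under [leRHS]eq_bigr do rewrite expr1n mulr1.
rewrite (big_ord_widen (maxn N (size p)) (fun m => p`_m)) ?leq_maxl//.
rewrite [leRHS](bigID (fun m : 'I_(maxn N (size p)) => (m < N)%N))/= lerDl.
by apply: sumr_ge0 => i _; exact: majorant_ge0.
Qed.

Lemma majorant_coef_bound a n m :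
  (majorant a n)`_m <= (`|a| + 1) * (al + be * (`|a| + 1)) ^+ n.
Proof.
apply: le_trans (majorant_sum a n m.+1).
by rewrite big_ord_recr/= lerDr; apply: sumr_ge0 => i _; exact: majorant_ge0.
Qed.

Lemma taylor_norm a n s :
  `|taylor a n s| <= (majorant a n)`_(size s) * \prod_(x <- s) `|x|.
Proof.
elim/ltn_ind: n s => -[|n] IH s.
  rewrite /majorant /taylor /srec/= coefD coefC coefX.
  case: s => [|x [|y s]] /=; rewrite ?big_nil ?big_seq1 ?addr0 ?add0r ?mulr1 ?mul1r//.
  by rewrite normr0 mul0r.
rewrite taylorS coef_majorantS normrZ normrN ger0_norm ?invr_ge0// -mulrA.
rewrite ler_wpM2l ?invr_ge0// mulrDl; apply: (le_trans (ler_normD _ _)); apply: lerD.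
  by rewrite -mulrA (le_trans (Aal _))// ler_wpM2l// IH.
rewrite -mulrA mulr_suml mulr_sumr.
apply: (le_trans (ler_norm_sum _ _ _)); apply: ler_sum => i _.
rewrite mulr_suml mulr_sumr.
apply: (le_trans (ler_norm_sum _ _ _)); apply: ler_sum => l _.
apply: (le_trans (Bbe _ _)); rewrite ler_wpM2l//.
have ls : (l <= size s)%N by rewrite -ltnS.
have /= H1 := IH i (ltn_ord i) (take l s).
have /= H2 := IH (n - i)%N (leq_subr _ _) (drop l s).
apply: (le_trans (ler_pM (normr_ge0 _) (normr_ge0 _) H1 H2)).
by rewrite size_takel// size_drop mulrACA -big_cat/= cat_take_drop.
Qed.

(** Degrees add under [B], and [(i + 1) + (n - i + 1) = n + 2]. However a longer list is cut, one of
    its two pieces is too long for its coefficient. *)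
Lemma taylor_eq0 a n s : (n.+1 < size s)%N -> taylor a n s = 0.
Proof.
elim/ltn_ind: n s => -[|n] IH s ns.
  by case: s ns => [|x [|y s]].
rewrite taylorS IH// ?linear_map0 ?add0r; last exact: ltnW.
rewrite big1 ?scaler0// => i _; rewrite big1// => l _.
have ls : (l <= size s)%N by rewrite -ltnS.
have [li|il] := ltnP i.+1 l.
  by rewrite (IH i (ltn_ord i)) ?(bilinear0l Bl) ?size_takel.
have ni : (i <= n)%N by rewrite -ltnS.
rewrite (IH (n - i)%N) ?(bilinear0r Br)// ?size_drop; lia.
Qed.

Lemma taylor_lin a n s1 s2 x y c :
  taylor a n (s1 ++ (c *: x + y) :: s2) =
  c *: taylor a n (s1 ++ x :: s2) + taylor a n (s1 ++ y :: s2).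
Proof.
elim/ltn_ind: n s1 s2 => -[|n] IH s1 s2.
  rewrite /taylor /srec/=; case: s1 => [|z [|z' s1]] /=; first by case: s2 => //; rewrite scaler0 addr0.
    by rewrite scaler0 addr0.
  by rewrite scaler0 addr0.
rewrite !taylorS !scalerA.
have E z : size (s1 ++ z :: s2) = (size s1 + (size s2).+1)%N by rewrite size_cat.
rewrite !E (mulrC c) -scalerA -scalerDr; congr (_ *: _).
rewrite IH// Al scalerDr addrACA; congr (_ + _).
rewrite scaler_sumr -big_split/=; apply: eq_bigr => i _.
rewrite scaler_sumr -big_split/=; apply: eq_bigr => l _.
(* Exactly one factor receives the distinguished entry: the right one for [l <= size s1], the left
   one for larger [l]. *)
rewrite !take_cat !drop_cat; have [ls|ls] := ltnP l (size s1).
  by rewrite (IH (n - i)%N) ?ltnS ?leq_subr// Br.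
case: (l - size s1)%N => [|j] /=; last by rewrite (IH i)// Bl.
by rewrite (IH (n - i)%N _ [::]) ?ltnS ?leq_subr// Br.
Qed.

(** Both sides obey the same recursion in [n], the sum over [m] turning into a sum over the pairs
    [l + j = m]. The identity is exact for every [N] beyond the degree [n + 1]. *)
Lemma taylor_shift a v n N : (n.+1 < N)%N ->
  taylor (a + v) n [::] = \sum_(m < N) taylor a n (nseq m v).
Proof.
elim/ltn_ind: n N => -[|n] IH N nN.
  case: N nN => [|[|N]]// _; rewrite !big_ord_recl/= big1 ?addr0// => i _.
rewrite taylorS.
under [RHS]eq_bigr => m _ do rewrite taylorS size_nseq.
rewrite -scaler_sumr big_split/=; congr (_ *: (_ + _)).
  by rewrite -(linear_map_sum N (fun m => taylor a n (nseq m v))) (IH n _ N)// ltnW.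
rewrite [RHS]exchange_big/=; apply: eq_bigr => i _.
rewrite big_ord1.
have ni : (i <= n)%N by rewrite -ltnS.
transitivity (\sum_(m < N) \sum_(l < m.+1)
    B (taylor a i (nseq l v)) (taylor a (n - i) (nseq (m - l) v))); last first.
  apply: eq_bigr => m _; apply: eq_bigr => l _.
  by rewrite take_nseq ?drop_nseq// -ltnS.
rewrite (sum_triangle (fun l j => B (taylor a i (nseq l v)) (taylor a (n - i) (nseq j v)))).
rewrite (IH i _ N) ?(IH (n - i)%N _ N); try lia.
rewrite (bilinear_suml Bl N (fun m => taylor a i (nseq m v))).
apply: eq_bigr => l _.
rewrite (bilinear_sumr Br N (fun m => taylor a (n - i) (nseq m v))).
(* A full product also contains pairs with [l + j >= N > n + 2]; for these, [l > i + 1] or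
   [j > n - i + 1], and one factor vanishes. *)
rewrite [LHS](bigID (fun j : 'I_N => (l + j < N)%N))/= [X in _ + X]big1 ?addr0// => j.
rewrite -leqNgt => Nlj; have [li|il] := ltnP i.+1 l.
  by rewrite (taylor_eq0 a) ?size_nseq// (bilinear0l Bl).
by rewrite [X in B _ X](taylor_eq0 a) ?size_nseq ?(bilinear0r Br)//; lia.
Qed.

Lemma cvg_linear_map (u : nat -> V) (l : V) : u @ \oo --> l -> (fun n => A (u n)) @ \oo --> A l.
Proof.
move=> /cvg_dist0P ul; apply/cvg_dist0P.
apply: (@squeeze_cvgr _ _ _ _ (fun=> 0) (fun n => al * `|l - u n|)).
- apply: nearW => n; rewrite normr_ge0/= (le_trans _ (Aal _))//.
  by rewrite -[- u n]scaleN1r linear_mapD linear_mapZ scaleN1r.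
- exact: cvg_cst.
- by rewrite -[0](mulr0 al); apply: cvgM => //; exact: cvg_cst.
Qed.

Section Flow.
Variables (a : V) (T : R).
Hypothesis T0 : 0 < T.
Hypothesis TM : T * (al + be * (`|a| + 1)) <= 1.

Let D := `|a| + 1.

Let D0 : 0 <= D. Proof. by rewrite addr_ge0. Qed.

Lemma majorant_geometric k (P : R) : 0 <= P ->
  D * (al + be * D) ^+ k * P * T ^+ k <= D * P.
Proof.
move=> P0; rewrite -!mulrA ler_wpM2l// mulrCA ler_piMr//.
rewrite -exprMn mulrC exprn_ile1//.
by rewrite mulr_ge0 ?(ltW T0)// addr_ge0// mulr_ge0.
Qed.

Lemma taylor_coef_bound s :
  coef_bound T (D * \prod_(x <- s) `|x|) (fun k => taylor a k s).
Proof.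
move=> k; have P0 : 0 <= \prod_(x <- s) `|x| by apply: prodr_ge0.
apply: le_trans (majorant_geometric k P0); rewrite ler_wpM2r ?exprn_ge0 ?(ltW T0)//.
apply: (le_trans (taylor_norm _ _ _)); rewrite ler_wpM2r//.
exact: majorant_coef_bound.
Qed.

(** For [|v| < 1] the value of the majorant at 1 dominates all degrees together, so the bound does
    not depend on [N]. *)
Lemma taylor_sum_coef_bound v N : `|v| < 1 ->
  coef_bound T D (fun k => \sum_(m < N) taylor a k (nseq m v)).
Proof.
move=> v1 k; have := majorant_geometric k ler01; rewrite !mulr1; apply: le_trans.
rewrite ler_wpM2r ?exprn_ge0 ?(ltW T0)//.
apply: le_trans (majorant_sum a k N).
apply: (le_trans (ler_norm_sum _ _ _)); apply: ler_sum => m _.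
apply: (le_trans (taylor_norm _ _ _)); rewrite size_nseq.
rewrite -[leRHS]mulr1 ler_wpM2l ?majorant_ge0// big_nseq iter_mulr_1.
by rewrite exprn_ile1// ltW.
Qed.

(** The condition relating [T] to the data is imposed at [a] only, yet it controls the solutions
    starting in the whole unit ball around [a]. *)
Lemma taylor_shift_coef_bound v : `|v| < 1 ->
  coef_bound T D (fun k => taylor (a + v) k [::]).
Proof.
by move=> v1 k; rewrite (@taylor_shift a v k k.+2)//; exact: taylor_sum_coef_bound.
Qed.

End Flow.

Definition flow v (t : R) : V := psum (fun n => taylor v n [::]) t.

Lemma taylor_nil_coef_bound a T : 0 < T -> T * (al + be * (`|a| + 1)) <= 1 ->
  coef_bound T (`|a| + 1) (fun k => taylor a k [::]).
Proof.
by move=> T0 TM; have := taylor_coef_bound T0 TM [::]; rewrite big_nil mulr1.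
Qed.

Lemma in_itvNN (T t : R) : (t \in `]- T, T[%R) = (`|t| < T).
Proof. by rewrite in_itv/= -ltr_norml. Qed.

Lemma flow0 a : flow a 0 = a.
Proof. by rewrite /flow psum0. Qed.

Lemma flow_smooth a T : 0 < T -> T * (al + be * (`|a| + 1)) <= 1 ->
  smooth_curve T (flow a).
Proof.
move=> T0 TM n t; rewrite in_itvNN => tT.
by have [] := derive1n_psum n T0 (taylor_nil_coef_bound T0 TM) (fun _ _ => erefl) tT.
Qed.

Lemma flow_equation a T t : 0 < T -> T * (al + be * (`|a| + 1)) <= 1 ->
  `|t| < T -> derive1 (flow a) t = - (A (flow a t) + B (flow a t) (flow a t)).
Proof.
move=> T0 TM tT; have cb := taylor_nil_coef_bound T0 TM.
have [_ dE] := derive1n_psum 1 T0 cb (fun _ _ => erefl) tT.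
rewrite -derive1n1 dE /=; apply: cvg_lim; first exact: norm_hausdorff.
have -> : series (fun k => t ^+ k *: dcoef (fun k => taylor a k [::]) k) =
  (fun n => - (A (series (fun k => t ^+ k *: taylor a k [::]) n) +
    series (fun k => t ^+ k *: \sum_(i < k.+1) B (taylor a i [::]) (taylor a (k - i)%N [::])) n)).
  apply/funext => n; rewrite /series/= !big_mkord.
  rewrite (linear_map_sum n (fun k => t ^+ k *: taylor a k [::])) -big_split/= -sumrN.
  apply: eq_bigr => k _; rewrite /dcoef taylorS linear_mapZ -scalerDr -scalerN; congr (_ *: _).
  rewrite scalerA mulrN divff ?pnatr_eq0// scaleN1r; congr (- (_ + _)).
  by apply: eq_bigr => i _; rewrite big_ord1.
apply: cvgN; apply: cvgD.
  by apply: cvg_linear_map; exact: psum_is_cvg cb tT.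
exact: (psum_bilinear T0 Bl Br be0 Bbe cb cb tT).
Qed.

(** Families indexed by ['I_n] become lists by enumeration. A modified value sits at a place that
    depends neither on [h] nor on [z], so multilinearity reduces to linearity in one entry of a
    list. *)
Lemma enum_dfwith n (i : 'I_n) : exists s1 s2 : seq 'I_n, forall (h : 'I_n -> V) z,
  [seq dfwith h i z j | j <- enum 'I_n] = [seq h j | j <- s1] ++ z :: [seq h j | j <- s2].
Proof.
have [s1 [s2 E]] : exists s1 s2 : seq 'I_n, enum 'I_n = s1 ++ i :: s2.
  have : i \in enum 'I_n by rewrite mem_enum.
  by case/splitPr => s1 s2; exists s1, s2.
have : uniq (enum 'I_n) by exact: enum_uniq.
rewrite E cat_uniq/= negb_or => /and3P[_ /andP[is1 _] /andP[is2 _]].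
exists s1, s2 => h z; rewrite map_cat/= dfwithin; congr (_ ++ _ :: _).
  by apply/eq_in_map => j js; rewrite dfwithout//; apply: contraNneq is1 => ->.
by apply/eq_in_map => j js; rewrite dfwithout//; apply: contraNneq is2 => ->.
Qed.

Lemma ex_contraction_ratio (S T : R) : 0 < T -> S < T ->
  exists q, [/\ 0 < q, q < 1 & S < q * T].
Proof.
move=> T0 ST; have [S0|S0] := ltP S 0.
  by exists 2^-1; split; [lra|lra|apply: lt_trans S0 _; rewrite mulr_gt0// invr_gt0].
have ST1 : S / T < 1 by rewrite ltr_pdivrMr// mul1r.
have ST0 : 0 <= S / T by rewrite divr_ge0// ltW.
exists ((S / T + 1) / 2); split; [lra|lra|].
by rewrite -ltr_pdivrMr//; lra.
Qed.

Lemma flow_analytic a T : 0 < T -> T * (al + be * (`|a| + 1)) <= 1 ->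
  analytic_at T flow a.
Proof.
move=> T0 TM; set D := `|a| + 1.
pose P n (h : 'I_n -> V) t := psum (fun k => taylor a k [seq h i | i <- enum 'I_n]) t.
have cbP n (h : 'I_n -> V) : coef_bound T (D * \prod_(i < n) `|h i|)
    (fun k => taylor a k [seq h i | i <- enum 'I_n]).
  have := taylor_coef_bound T0 TM [seq h i | i <- enum 'I_n].
  by rewrite big_map big_enum.
(* With radius 1 the powers of [r] disappear, and the growth condition is the bound [cbP]
   differentiated [m] times. *)
exists 1, P; split => //.
- move=> n h i c x y t; rewrite in_itvNN => tT.
  have [s1 [s2 E]] := enum_dfwith i.
  have cx := cbP n (dfwith h i x); have cy := cbP n (dfwith h i y).
  rewrite /P -(psum_lin c T0 cx cy tT); congr psum; apply/funext => k.
  by rewrite !E taylor_lin.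
- move=> n h j t; rewrite in_itvNN => tT.
  by have [] := derive1n_psum j T0 (cbP n h) (fun _ _ => erefl) tT.
- move=> m S ST; have [q [q0 q1 SqT]] := ex_contraction_ratio T0 ST.
  have [C C0 bC]   := psum_iter_dcoef_bound (V := V) m T0 q0 q1 SqT.
  exists (C * D) => n h t; rewrite in_itv/= -ler_norml => tS.
  have [_ ->] := derive1n_psum m T0 (cbP n h) (fun _ _ => erefl) (le_lt_trans tS ST).
  have := bC _ _ 0%N t (cbP n h) _ tS; rewrite expr0 expr1n !mulr1 -mulrA.
  exact.
move=> v v1 m S ST; have [q [q0 q1 SqT]] := ex_contraction_ratio T0 ST.
have [C C0 bC]   := psum_iter_dcoef_bound (V := V) m T0 q0 q1 SqT.
have cbv := taylor_shift_coef_bound T0 TM v1.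
pose e N k := \sum_(n < N) taylor a k (nseq n v).
have cbe N : coef_bound T D (e N) by exact: taylor_sum_coef_bound.
have codomE n : [seq v | _ <- enum 'I_n] = nseq n v.
  by rewrite -[in RHS](size_enum_ord n); elim: (enum 'I_n) => //= _ s ->.
have PE N t : `|t| < T -> \sum_(n < N) P n (fun=> v) t = psum (e N) t.
  move=> tT; elim: N => [|N IH].
    rewrite big_ord0 /e; under [X in psum X]eq_fun do rewrite big_ord0.
    apply/esym; apply: cvg_lim; first exact: norm_hausdorff.
    apply: cvg_near_cst; apply: nearW => n.
    by rewrite /series/= big1// => i _; rewrite scaler0.
  rewrite big_ord_recr/= IH /P codomE.
  have cbN := cbP N (fun=> v); rewrite codomE in cbN.
  rewrite addrC -[psum _ t in LHS]scale1r -(psum_lin 1 T0 cbN (cbe N) tT).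
  by congr psum; apply/funext => k; rewrite scale1r /e big_ord_recr/= addrC.
(* The coefficients of the flow and of its truncation agree below index [N - 1], and [m]
   differentiations lower this to [N - m - 1]. Each of the two series has the bound [D], whence
   [2 * D] for their difference. *)
have key N t : `|t| <= S ->
    `|derive1n m (flow (a + v)) t - derive1n m (fun t => \sum_(n < N) P n (fun=> v) t) t|
    <= C * (2 * D) * q ^+ (N - m.+1).
  move=> tS; have tT := le_lt_trans tS ST.
  have [_ ->] := derive1n_psum m T0 cbv (fun _ _ => erefl) tT.
  have [_ ->] := derive1n_psum m T0 (cbe N) (PE N) tT.
  rewrite addrC -scaleN1r -(psum_iter_dcoef_lin (-1) m T0 (cbe N) cbv tT).
  apply: bC => //.
    move=> k; rewrite scaleN1r addrC.
    apply: (@le_trans _ _ ((`|taylor (a + v) k [::]| + `|e N k|) * T ^+ k)).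
      by rewrite ler_wpM2r ?exprn_ge0 ?(ltW T0)// ler_normB.
    by rewrite mulrDl mulr_natl mulr2n; apply: lerD; [exact: cbv|exact: cbe].
  move=> k kN; apply: (iter_dcoef0 _ kN) => j jN.
  have jN' : (j.+1 < N)%N by clear -kN jN; lia.
  by rewrite scaleN1r addrC /e -taylor_shift// subrr.
move=> Q /uniform_nbhs[E [entE EQ]].
move: entE; rewrite -entourage_ballE => -[eps /= eps0 epsE].
have : C * (2 * D) * q ^+ n @[n --> \oo] --> (0 : R).
  rewrite -[0](mulr0 (C * (2 * D))); apply: cvgM; first exact: cvg_cst.
  by apply: cvg_expr; rewrite ger0_norm ?ltW.
move=> /cvgr0_norm_lt/(_ _ eps0)[j0 _ Hj].
(* From here on the truncated difference [N - m.+1] is at least [j0]. *)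
exists (j0 + m.+1)%N => // N /= jN; apply: EQ => t; rewrite /= in_itv/= -ler_norml => tS.
apply: epsE; rewrite /= -ball_normE/=; apply: (le_lt_trans (key N t tS)).
apply: (le_lt_trans (ler_norm _)); apply: Hj => /=.
by clear -jN; lia.
Qed.

End Quadratic.

(** * The initial value problem *)

Section Operators.
Context {R : realType}.
Variables (k : nat) (theta : R).
Local Notation E := (holder k theta).

Lemma holder_le (f : E) x : `|f x| <= `|f|.
Proof. exact: (holder_bound_sup (holder_bound_fun f)). Qed.

Lemma holder_continuous (f : E) : continuous f.
Proof. exact: (holder_bound_continuous (holder_bound_fun f)). Qed.

Lemma holder_eqP (f g : E) : (forall x, f x = g x) -> f = g.
Proof. by move=> fg; apply: val_inj; apply/funext. Qed.

Hypothesis theta01 : 0 <= theta <= 1.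

(** The choice is [A f = K * f] and [B(f, g) = (K * (f g)) / 2]. Each use of the convolution or
    product estimate costs a factor [k + 2] for the return to the norm. *)
Lemma bbm_operators : exists (A : E -> E) (B : E -> E -> E) (al be : R),
  [/\ 0 <= al, 0 <= be & [/\
     forall x y s, A (s *: x + y) = s *: A x + A y,
     forall x y z s, B (s *: x + y) z = s *: B x z + B y z,
     forall x y z s, B x (s *: y + z) = s *: B x y + B x z,
     forall x, `|A x| <= al * `|x| &
     forall x y, `|B x y| <= be * (`|x| * `|y|)]] /\
  forall (u : E) x, (A u + B u u : E) x =
    convolution bbm_kernel (fun y => u y + u y ^+ 2 / 2) x.
Proof.
have [C C0 hC] := holder_bound_convolution theta01 k.
have [C' C'0 hC'] := holder_boundM theta01 k.
pose L (f : E) : E := Holder (holder_bound_pred (hC _ _ (holder_bound_fun f)).1).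
pose P (f g : E) : E :=
  Holder (holder_bound_pred (hC' _ _ _ _ (holder_bound_fun f) (holder_bound_fun g))).
have Ll x y s : L (s *: x + y) = s *: L x + L y.
  apply: holder_eqP => z.
  have := convolution_bbm_kernel_linear s (@holder_continuous x) (holder_le x)
    (@holder_continuous y) (holder_le y).
  by move/(congr1 (fun h => h z)).
have Lb f : `|L f| <= k.+2%:R * C * `|f|.
  by rewrite -mulrA; apply: holder_bound_norm_le; exact: (hC _ _ (holder_bound_fun f)).1.
have Pb f g : `|P f g| <= k.+2%:R * C' * (`|f| * `|g|).
  rewrite -mulrA; apply: holder_bound_norm_le.
  exact: (hC' _ _ _ _ (holder_bound_fun f) (holder_bound_fun g)).
have Pl x y z s : P (s *: x + y) z = s *: P x z + P y z.
  by apply: holder_eqP => w; rewrite /= mulrDl -mulrA.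
have Pr x y z s : P x (s *: y + z) = s *: P x y + P x z.
  by apply: holder_eqP => w; rewrite /= mulrDr mulrCA.
exists L, (fun f g => 2^-1 *: L (P f g)), (k.+2%:R * C), (2^-1 * (k.+2%:R * C * (k.+2%:R * C'))).
split; first split.
- by rewrite mulr_ge0.
- by rewrite !mulr_ge0// invr_ge0.
- split => //.
  + by move=> x y z s; rewrite Pl Ll scalerDr scalerA mulrC -scalerA.
  + by move=> x y z s; rewrite Pr Ll scalerDr scalerA mulrC -scalerA.
  + move=> x y; rewrite normrZ ger0_norm ?invr_ge0// -!mulrA ler_wpM2l ?invr_ge0//.
    apply: (le_trans (Lb _)).
    apply: (@le_trans _ _ (k.+2%:R * C * (k.+2%:R * C' * (`|x| * `|y|)))).
      by rewrite ler_wpM2l ?mulr_ge0.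
    by rewrite !mulrA.
move=> u x.
have := convolution_bbm_kernel_linear 2^-1 (@holder_continuous (P u u)) (holder_le (P u u))
    (@holder_continuous u) (holder_le u).
move=> /(congr1 (fun h => h x)) H; rewrite -[LHS]/(L u x + 2^-1 * L (P u u) x) addrC -H.
by congr convolution; apply/funext => y /=; rewrite addrC mulrC expr2.
Qed.

End Operators.

(** * Uniqueness by exponentially weighted sup norms *)

Section Uniqueness.
Context {R : realType}.

(** The function [f - c exp(L s)] has a nonpositive derivative and starts at [-c <= 0]. *)
Lemma ler_exp_primitive (f f' : R -> R) (c L t : R) : 0 <= t -> 0 <= c ->
  (forall s, 0 <= s <= t -> is_derive s 1 f (f' s) /\ f' s <= c * L * expR (L * s)) ->
  f 0 = 0 -> f t <= c * expR (L * t).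
Proof.
move=> t0 c0 H f0.
pose g s := f s - c * expR (L * s).
have dg s : 0 <= s <= t -> is_derive s 1 g (f' s - c * L * expR (L * s)).
  move=> /H[df _]; have dL : is_derive s 1 (fun z : R => L * z) L.
    by have := @is_deriveZ _ _ _ id L s 1 1 (is_derive_id s 1); rewrite /GRing.scale/= mulr1.
  have dE := is_derive1_comp (is_derive_expR (L * s)) dL.
  apply: (is_derive_eq (is_deriveB df (is_deriveZ c dE))).
  by rewrite /GRing.scale/=; ring.
have cg : {within `[0, t], continuous g}.
  apply: derivable_within_continuous => s; rewrite in_itv/= => /dg[].
  by [].
have [z zt gE] := @MVT_segment _ g (fun s => f' s - c * L * expR (L * s)) 0 t t0
   (fun s st => dg s (ltac:(by move: st; rewrite in_itv/= => /andP[/ltW -> /ltW ->]))) cg.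
have : g t <= g 0.
  rewrite -subr_le0 gE subr0 mulr_le0_ge0// subr_le0.
  by move: zt; rewrite in_itv/= => /H[].
rewrite /g f0 mulr0 expR0 mulr1 sub0r; lra.
Qed.

Lemma ler_norm_exp_primitive (f f' : R -> R) (c L S t : R) : 0 <= c ->
  (forall s : R, `|s| <= S -> is_derive s 1 f (f' s) /\ `|f' s| <= c * L * expR (L * `|s|)) ->
  f 0 = 0 -> `|t| <= S -> `|f t| <= c * expR (L * `|t|).
Proof.
move=> c0 H f0 tS.
have half (f1 f1' : R -> R) t1 : 0 <= t1 -> t1 <= S ->
   (forall s : R, `|s| <= S -> is_derive s 1 f1 (f1' s) /\ `|f1' s| <= c * L * expR (L * `|s|)) ->
   f1 0 = 0 -> `|f1 t1| <= c * expR (L * t1).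
  move=> t10 t1S H1 f10; rewrite ler_norml lerNl; apply/andP; split.
    apply: (@ler_exp_primitive (- f1) (- f1')) => //; last by rewrite fctE f10 oppr0.
    move=> s /andP[s0 st]; have [|d1 d2] := H1 s; first by rewrite ger0_norm// (le_trans st).
    split; first exact: is_deriveN.
    by rewrite fctE (le_trans (ler_norm _))// normrN -[in leRHS](ger0_norm s0).
  apply: (@ler_exp_primitive f1 f1') => //.
  move=> s /andP[s0 st]; have [|d1 d2] := H1 s; first by rewrite ger0_norm// (le_trans st).
  by split => //; rewrite (le_trans (ler_norm _))// -[in leRHS](ger0_norm s0).
have [t0|t0] := leP 0 t.
  by rewrite (ger0_norm t0); apply: (half f f') => //; rewrite -(ger0_norm t0).
rewrite (ltr0_norm t0) -[in leLHS](opprK t).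
apply: (half (fun s => f (- s)) (fun s => - f' (- s))).
- by rewrite oppr_ge0 ltW.
- by rewrite -(ltr0_norm t0).
- move=> s sS; have [|d1 d2] := H (- s); first by rewrite normrN.
  split; last by rewrite normrN -(normrN s).
  have dN : is_derive s 1 (-%R : R -> R) (-1) by exact: is_deriveNid.
  have := is_derive1_comp d1 dN.
  by rewrite mulrN1.
- by rewrite oppr0.
Qed.

Variables (k : nat) (theta : R).
Local Notation E := (holder k theta).

(** Evaluation at [x] is a linear form of norm at most 1. It reduces a curve in the function space
    to real functions of [t]. *)
Lemma is_derive_holder_eval (u : R -> E) (du : E) (t x : R) :
  is_derive t 1 u du -> is_derive t 1 (fun s => u s x) (du x).
Proof.
move=> /is_derive1_cvg/cvgrPdist_le H; apply: cvg_is_derive1; apply/cvgrPdist_le => e e0.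
apply: filterS (H e e0) => h; apply: le_trans.
exact: (holder_le (du - h^-1 *: (u (h + t) - u t)) x).
Qed.

Lemma smooth_curve_bounded (T S : R) (u : R -> E) : smooth_curve T u -> 0 <= S -> S < T ->
  exists M, forall t, `|t| <= S -> `|u t| <= M.
Proof.
move=> su S0 ST.
have c : {within `[- S, S], continuous (fun t => `|u t|)}.
  apply: continuous_in_subspaceT => t; rewrite inE/= in_itv/= -ler_norml => tS.
  apply: (@continuous_comp _ _ _ u Num.norm); last exact: norm_continuous.
  apply: differentiable_continuous; apply/derivable1_diffP.
  by apply: (su 0%N); rewrite in_itvNN (le_lt_trans tS).
have SS : - S <= S by rewrite (le_trans _ S0)// oppr_le0.
have [z _ zM] := EVT_max SS c; exists `|u z| => t tS.
by apply: zM; rewrite in_itv/= -ler_norml.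
Qed.

(** The difference of the nonlinearities factors as [(1 + (f + g)/2) (f - g)], and convolution with
    the kernel does not increase suprema. The difference enters only through its supremum, into
    which a weighted bound at a fixed time can be inserted. *)
Lemma convolution_bbm_lipschitz (f g : E) (M m : R) : `|f| <= M -> `|g| <= M ->
  (forall y, `|f y - g y| <= m) -> forall x,
  `|convolution bbm_kernel (fun y => f y + f y ^+ 2 / 2) x
    - convolution bbm_kernel (fun y => g y + g y ^+ 2 / 2) x| <= (1 + M) * m.
Proof.
move=> fM gM fgm x.
have cq (h : E) : continuous (fun y => h y + h y ^+ 2 / 2).
  move=> y; have ch := @holder_continuous _ _ _ h y.
  by apply: cvgD => //; apply: cvgM; [exact: cvgM|exact: cvg_cst].
have bq (h : E) : `|h| <= M -> forall y, `|h y + h y ^+ 2 / 2| <= M + M ^+ 2 / 2.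
  move=> hM y; have hyM := le_trans (holder_le h y) hM.
  apply: (le_trans (ler_normD _ _)); apply: lerD => //.
  rewrite normrM normrX [`|2^-1|]ger0_norm ?invr_ge0// ler_wpM2r ?invr_ge0//.
  by rewrite lerXn2r// nnegrE (le_trans _ hyM).
have := convolution_bbm_kernel_linear (-1) (cq g) (bq g gM) (cq f) (bq f fM).
move=> /(congr1 (fun h => h x)); rewrite mulN1r addrC => <-.
apply: convolution_bbm_kernel_bound => y.
  by apply: cvgD; [apply: cvgM; [exact: cvg_cst|exact: cq]|exact: cq].
have -> : -1 * (g y + g y ^+ 2 / 2) + (f y + f y ^+ 2 / 2) =
   (1 + (f y + g y) / 2) * (f y - g y) by field.
rewrite normrM; apply: ler_pM => //.
apply: (le_trans (ler_normD _ _)); rewrite normr1 lerD2l.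
rewrite normrM [`|2^-1|]ger0_norm ?invr_ge0//.
have := le_trans (holder_le f y) fM; have := le_trans (holder_le g y) gM.
by have := ler_normD (f y) (g y); lra.
Qed.

Lemma bbm_solution_unique (T : R) (v : E) (u w : R -> E) :
  bbm_solution T v u -> bbm_solution T v w ->
  forall t, t \in `]- T, T[%R -> w t = u t.
Proof.
move=> [su eu u0] [sw ew w0] t0; rewrite in_itvNN => t0T.
pose S := `|t0|.
have [Mu uM] := smooth_curve_bounded su (normr_ge0 t0) t0T.
have [Mw wM] := smooth_curve_bounded sw (normr_ge0 t0) t0T.
pose M := Num.max Mu Mw.
have {}uM t : `|t| <= S -> `|u t| <= M by move=> /uM uM'; rewrite /M le_max uM'.
have {}wM t : `|t| <= S -> `|w t| <= M by move=> /wM wM'; rewrite /M le_max wM' orbT.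
have M0 : 0 <= M by apply: le_trans (normr_ge0 _) (uM 0 _); rewrite normr0 normr_ge0.
(* Twice the Lipschitz constant: integrating a bound by a multiple of [exp(L |s|)] then halves that
   multiple. The iteration starts from [2 M], since both solutions are bounded by [M] on
   [[-S, S]]. *)
pose L := 2 * (1 + M).
have key n t x : `|t| <= S -> `|w t x - u t x| <= 2 * M * 2^-1 ^+ n * expR (L * `|t|).
  elim: n t x => [|n IH] t x tS.
    rewrite expr0 mulr1 (@le_trans _ _ (2 * M))//.
      apply: (le_trans (ler_normB _ _)).
      have := le_trans (holder_le (w t) x) (wM t tS).
      have := le_trans (holder_le (u t) x) (uM t tS); lra.
    rewrite ler_peMr ?mulr_ge0// -expR0 ler_expR mulr_ge0// /L mulr_ge0//.
    by rewrite addr_ge0.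
  apply: (@ler_norm_exp_primitive (fun s => w s x - u s x)
     (fun s => derive1 w s x - derive1 u s x) _ _ S) => //.
  - by rewrite !mulr_ge0// exprn_ge0// invr_ge0.
  - move=> s sS; have sT : s \in `]- T, T[%R by rewrite in_itvNN (le_lt_trans sS).
    have dw : is_derive s 1 w (derive1 w s) by apply: is_derive1P => //; exact: (sw 0%N).
    have du : is_derive s 1 u (derive1 u s) by apply: is_derive1P => //; exact: (su 0%N).
    split.
      exact: (is_deriveB (is_derive_holder_eval x dw) (is_derive_holder_eval x du)).
    have -> : derive1 w s x = - convolution bbm_kernel (fun y => w s y + w s y ^+ 2 / 2) x.
      by apply/eqP; rewrite -addr_eq0; apply/eqP; exact: ew.
    have -> : derive1 u s x = - convolution bbm_kernel (fun y => u s y + u s y ^+ 2 / 2) x.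
      by apply/eqP; rewrite -addr_eq0; apply/eqP; exact: eu.
    rewrite -opprD normrN.
    apply: (le_trans (convolution_bbm_lipschitz (wM s sS) (uM s sS) (fun y => IH s y sS) x)).
    by rewrite /L exprS le_eqVlt; apply/orP; left; apply/eqP; field.
  - by rewrite u0 w0 subrr.
apply: holder_eqP => x; apply/eqP; rewrite -subr_eq0 -normr_le0.
apply/ler_addgt0Pr => e e0; rewrite add0r.
have : (2 * M * expR (L * `|t0|)) * 2^-1 ^+ n @[n --> \oo] --> (0 : R).
  rewrite -[0](mulr0 (2 * M * expR (L * `|t0|))); apply: cvgM; first exact: cvg_cst.
  by apply: cvg_expr; rewrite ger0_norm ?invr_ge0// invf_lt1// ltr1n.
move=> /cvgr0_norm_le/(_ _ e0)[n _ Hn].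
have := Hn n (leqnn n); apply: le_trans; apply: le_trans (ler_norm _).
by apply: (le_trans (key n t0 x (lexx _))); rewrite mulrAC.
Qed.

End Uniqueness.

Unset Implicit Arguments.

Theorem theorem1p2 (R : realType) (k : nat) (theta : R)
    (htheta : 0 <= theta <= 1) :
  exists T : R -> R, (forall rho, 0 <= rho -> 0 < T rho) /\
  forall u0 : holder k theta,
    (exists u : R -> holder k theta, bbm_unique_solution (T `|u0|) u0 u) /\
    (exists (delta : R) (Phi : holder k theta -> R -> holder k theta),
      [/\ 0 < delta,
          forall v, `|v - u0| < delta ->
            bbm_unique_solution (T `|u0|) v (Phi v) &
          forall a, `|a - u0| < delta -> analytic_at (T `|u0|) Phi a]).
Proof.
have [A [B [al [be [[al0 be0 [Al Bl Br Aal Bbe]] AB]]]]] := bbm_operators k htheta.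
(* 2 = 1 + 1: the data range over the unit ball around u0, and the expansions at
   these data have radius 1. *)
pose T rho := (1 + al + be * (rho + 2))^-1.
(* The summand 1 keeps the denominator of [T] positive even if [al] and [be] are both 0. *)
have T0 rho : 0 <= rho -> 0 < T rho.
  by move=> rho0; rewrite invr_gt0 ltr_wpDr ?mulr_ge0 ?addr_ge0// ltr_pwDl.
exists T; split => // u0.
have TM v : `|v - u0| < 1 -> T `|u0| * (al + be * (`|v| + 1)) <= 1.
  move=> vu; have Tu0 := T0 _ (normr_ge0 u0).
  rewrite mulrC -ler_pdivlMr// /T div1r invrK.
  have v1 : `|v| + 1 <= `|u0| + 2.
    have := ler_normD (v - u0) u0; rewrite subrK; lra.
  by have := ler_wpM2l be0 v1; lra.
have sol v : `|v - u0| < 1 -> bbm_unique_solution (T `|u0|) v (flow A B v).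
  move=> vu; have Tu0 := T0 _ (normr_ge0 u0); have TMv := TM v vu.
  have s : bbm_solution (T `|u0|) v (flow A B v).
    split.
    - exact: (flow_smooth al0 be0 Aal Bbe Tu0 TMv).
    - move=> t; rewrite in_itvNN => tT x.
      rewrite (flow_equation Al Bl Br al0 be0 Aal Bbe Tu0 TMv tT) -AB.
      exact: addNr.
    - exact: flow0.
  by split => // w sw; exact: (bbm_solution_unique s sw).
split; first by exists (flow A B u0); apply: sol; rewrite subrr normr0.
exists 1, (flow A B); split => // a au.
exact: (flow_analytic Al Bl Br al0 be0 Aal Bbe (T0 _ (normr_ge0 u0)) (TM a au)).
Qed.
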